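(* Suppose $\sigma(x)/x\in\mathbb{Z}[\zeta_p]$. Then $\mathcal{I}=x\mathcal{O}_{\mathbb{KL}}$ is the principal ideal generated by $x$; with $\beta=p^{-2}\left(\frac1k-\frac\theta{2k}\right)$ the lattice $\varphi_\beta(\mathcal{I})$ (a rotated version of $\mathbb{Z}^n$) has minimum product distance $d_{p,\min}(\varphi_\beta(\mathcal{I}))=p^{(k-n)/2}\,2^{(l-n(m-1))/2}$; and $|N_{\mathbb{KL}}(x)|=p^{(n+k)/2}$.
   Context: Let $l>1$ be odd and $p$ a prime with $p\equiv1\pmod l$; let $\zeta_p=e^{2\pi i/p}$, $r$ a primitive root mod $p$, $\sigma\in\mathrm{Gal}(\mathbb{Q}(\zeta_p)/\mathbb{Q})$ with $\sigma(\zeta_p)=\zeta_p^r$, $\mathbb{K}=\{y\in\mathbb{Q}(\zeta_p):\sigma^l(y)=y\}$ (totally real, degree $l$). Let $\alpha=\prod_{j=0}^{(p-3)/2}(1-\zeta_p^{r^j})$, $\lambda$ an integer with $\lambda(r-1)\equiv1\pmod p$, $z=\zeta_p^\lambda\alpha(1-\zeta_p)$, $x=\sum_{j=1}^{(p-1)/l}\sigma^{jl}(z)\in\mathcal{O}_\mathbb{K}$, and $I=\mathbb{Z}x+\dots+\mathbb{Z}\sigma^{l-1}(x)$. Let $m\ge3$, $k=2^{m-2}$, $\omega=e^{2\pi i/2^m}$, $\theta=\omega+\omega^{-1}$, $\mathbb{L}=\mathbb{Q}(\theta)$ (totally real, degree $k$). Let $n=kl$, $\mathbb{KL}$ the compositum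 (totally real of degree $n$), and $\mathcal{I}=I\mathcal{O}_\mathbb{L}$ the $\mathbb{Z}$-module generated by all products $ab$ with $a\in I$, $b\in\mathcal{O}_\mathbb{L}$. For totally positive $\beta\in\mathbb{KL}$, $\varphi_\beta(y)=(\sqrt{\rho(\beta)}\rho(y))_\rho\in\mathbb{R}^n$, $\rho$ running over the $n$ real embeddings of $\mathbb{KL}$. $d_{p,\min}(\Lambda)=\inf\{|y_1\cdots y_n|:0\ne y\in\Lambda\}$; $N_{\mathbb{KL}}$ is the norm to $\mathbb{Q}$. *)

(* Defs.v *)
From HB Require Import structures.
From mathcomp Require Import all_boot all_order all_algebra all_field.
Set Implicit Arguments. Unset Strict Implicit. Unset Printing Implicit Defensive.
Import Order.TTheory GRing.Theory Num.Theory.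
Local Open Scope ring_scope.

(* zeta_p = e^{2 pi i / p} : p.-root (-1) is e^{i pi / p} (minimal argument). *)
Definition zeta (p : nat) : algC := (p.-root (-1)) ^+ 2.
(* omega = e^{2 pi i / 2^m} *)
Definition omega (m : nat) : algC := (2 ^ (m - 1))%N.-root (-1).
Definition theta (m : nat) : algC := omega m + (omega m)^-1.

Definition inQzeta (p : nat) (y : algC) : Prop :=
  y \in Crat_span (mkseq (fun i => zeta p ^+ i) p).
Definition inZzeta (p : nat) (y : algC) : Prop :=
  y \in Cint_span (mkseq (fun i => zeta p ^+ i) p).

Definition inK (p l : nat) (sigma : {rmorphism algC -> algC}) (y : algC) : Prop :=
  inQzeta p y /\ iter l sigma y = y.
(* L = Q(theta) (theta has degree 2^(m-2) <= 2^m) *)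
Definition inL (m : nat) (y : algC) : Prop :=
  y \in Crat_span (mkseq (fun i => theta m ^+ i) (2 ^ m)).
Definition inOL (m : nat) (y : algC) : Prop := inL m y /\ y \in Aint.

Definition inKL (p l : nat) (sigma : {rmorphism algC -> algC}) (m : nat) (y : algC) : Prop :=
  exists s : seq (algC * algC),
    (forall ab, ab \in s -> inK p l sigma ab.1 /\ inL m ab.2) /\
    y = \sum_(ab <- s) ab.1 * ab.2.
Definition inOKL (p l : nat) (sigma : {rmorphism algC -> algC}) (m : nat) (y : algC) : Prop := inKL p l sigma m y /\ y \in Aint.

Definition alpha (p r : nat) : algC :=
  \prod_(j < (p - 3)./2.+1) (1 - zeta p ^+ (r ^ j)).
Definition zz (p r : nat) (lambda : int) : algC :=
  zeta p ^ lambda * alpha p r * (1 - zeta p).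
Definition xx (p l r : nat) (lambda : int) (sigma : {rmorphism algC -> algC}) : algC :=
  \sum_(1 <= j < ((p - 1) %/ l).+1) iter (j * l) sigma (zz p r lambda).

Definition inI (p l r : nat) (lambda : int) (sigma : {rmorphism algC -> algC}) (y : algC) : Prop :=
  y \in Cint_span (mkseq (fun i => iter i sigma (xx p l r lambda sigma)) l).
Definition incalI (p l r : nat) (lambda : int) (sigma : {rmorphism algC -> algC}) (m : nat) (y : algC) : Prop :=
  exists s : seq (algC * algC),
    (forall ab, ab \in s -> inI p l r lambda sigma ab.1 /\ inOL m ab.2) /\
    y = \sum_(ab <- s) ab.1 * ab.2.

(* E : 'I_N -> Aut(algC) represents the embeddings of the field F (a subset of
   algC) into algC: restrictions to F pairwise distinct, and every embedding
   (every automorphism of algC restricted to F) is one of them. *)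
Definition embeddings_of (F : algC -> Prop) (N : nat)
    (E : 'I_N -> {rmorphism algC -> algC}) : Prop :=
  (forall i j : 'I_N, i != j -> exists y, F y /\ E i y != E j y) /\
  (forall f : {rmorphism algC -> algC}, exists i : 'I_N, forall y, F y -> f y = E i y).

Definition phi_coord N (E : 'I_N -> {rmorphism algC -> algC}) (beta y : algC) (i : 'I_N) : algC :=
  sqrtC (E i beta) * E i y.
Definition prod_dist N (E : 'I_N -> {rmorphism algC -> algC}) (beta y : algC) : algC :=
  \prod_(i < N) `|phi_coord E beta y i|.
Definition normKL N (E : 'I_N -> {rmorphism algC -> algC}) (y : algC) : algC :=
  \prod_(i < N) E i y.

(* Main.v *)
(** The element a = zeta^lambda alpha satisfies sigma a = -a and a^2 = +-p, which
    makes the conjugates of x orthogonal of square length p^2 for the trace of K.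
    In L the Dirichlet kernels f_j = sum_{|i| <= j} omega^i are a basis of
    O_L = Z[theta], orthonormal for Tr((2 - theta) u v) / 2k; products of the two
    bases give an orthonormal basis of calI.  As sigma(x)/x is integral, x^l is
    associated to a power p^f, where 2f > l because 1 - zeta divides x/a.
    Expanding xv (v in KL) in the conjugates of x, the coefficients are relative
    traces; such a trace is integral as soon as its argument has p-adic valuation
    greater than -1, because O_L/p is reduced.  With v in O_KL this gives
    x O_KL = calI, and with v a negative power of the uniformizer of K it excludes
    2f > l + 1. *)
Require Import Defs.
From HB Require Import structures.
From mathcomp Require Import all_boot all_order all_algebra all_field.
From mathcomp Require Import ring zify.
Import Order.TTheory GRing.Theory Num.Theory.
Local Open Scope ring_scope.

Set Implicit Arguments.
Unset Strict Implicit.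

(** * Divisibility among algebraic integers *)

Section AlgebraicIntegers.

Implicit Types e x y z : algC.

(** No prime ideals or valuations are introduced: in the ring of all algebraic integers, [p^c]
    dividing [x^l] says that x has p-adic valuation at least c/l, and integral closedness makes such
    statements about powers lossless. No description of O_K is needed; only O_L is computed, since a
    Frobenius congruence is checked on ring generators. The count that fixes the norm: if x^l is
    associated to p^f, the coefficients of xv are relative traces of p^-2 x x_i v, of valuation at
    least 2f/l - 2 + val(v). Integrality asks for more than -1. For v integral this is 2f > l; for v
    of valuation -1/l it would be 2f > l + 1, and then the non-integral v would give an element of
    calI, which lies in x O_KL. So 2f = l + 1. A second obstacle: [sigma] is prescribed only on
    [zeta p], so its powers cannot serve as embeddings of KL; automorphisms with prescribed action
    on both roots of unity are built separately. *)

Lemma dvdA_div e x : e != 0 -> (e %| x)%A = (x / e \in Aint).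
Proof. by move=> /negbTE e0; rewrite unfold_in e0. Qed.

Lemma dvdAP e x : reflect (exists2 z, z \in Aint & x = z * e) (e %| x)%A.
Proof.
apply: (iffP idP) => [|[z Az ->]].
  have [->|e0] := eqVneq e 0.
    by rewrite unfold_in eqxx => /eqP->; exists 0; rewrite ?mulr0.
  by rewrite dvdA_div // => Az; exists (x / e); rewrite ?divfK.
have [->|e0] := eqVneq e 0; first by rewrite mulr0 rpred0.
by rewrite dvdA_div // mulfK.
Qed.

Lemma dvdA_mull y e x : y \in Aint -> (e %| x)%A -> (e %| y * x)%A.
Proof.
by move=> Ay /dvdAP[z Az ->]; apply/dvdAP; exists (y * z); rewrite ?mulrA ?rpredM.
Qed.

Lemma dvdA_mulr y e x : y \in Aint -> (e %| x)%A -> (e %| x * y)%A.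
Proof. by rewrite mulrC; apply: dvdA_mull. Qed.

Lemma dvdA_refl e : (e %| e)%A.
Proof. by apply/dvdAP; exists 1; rewrite ?mul1r. Qed.

Lemma dvdA_trans y e x : (e %| y)%A -> (y %| x)%A -> (e %| x)%A.
Proof. by move=> ey /dvdAP[z Az ->]; apply: dvdA_mull. Qed.

Lemma dvdA_mul e x e' x' : (e %| x)%A -> (e' %| x')%A -> (e * e' %| x * x')%A.
Proof.
move=> /dvdAP[z Az ->] /dvdAP[z' Az' ->].
by apply/dvdAP; exists (z * z'); rewrite ?rpredM // mulrACA.
Qed.

Lemma dvdA_exp n e x : (e %| x)%A -> (e ^+ n %| x ^+ n)%A.
Proof.
by move=> ex; elim: n => [|n IH]; rewrite ?dvdA_refl // !exprS dvdA_mul.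
Qed.

Lemma dvdA_prod (I : Type) (s : seq I) (P : pred I) (F G : I -> algC) :
  (forall i, P i -> (F i %| G i)%A) ->
  (\prod_(i <- s | P i) F i %| \prod_(i <- s | P i) G i)%A.
Proof. by move=> FG; elim/big_ind2: _ => // *; rewrite ?dvdA_refl ?dvdA_mul. Qed.

Lemma dvdA_exp2l n m e : e \in Aint -> (n <= m)%N -> (e ^+ n %| e ^+ m)%A.
Proof.
by move=> Ae /subnK <-; rewrite exprD; apply: dvdA_mull; rewrite ?dvdA_refl ?rpredX.
Qed.

Lemma Aint_dvdA e x : e \in Aint -> (e %| x)%A -> x \in Aint.
Proof. by move=> Ae /dvdAP[z Az ->]; rewrite rpredM. Qed.

Lemma dvdA_mul2l z e x : z != 0 -> (z * e %| z * x)%A = (e %| x)%A.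
Proof.
move=> z0; apply/idP/idP => [/dvdAP[y Ay] | ]; last by apply/dvdA_mul/dvdA_refl.
by rewrite mulrCA => /(mulfI z0) ->; apply/dvdAP; exists y.
Qed.

Lemma dvdA_aut (nu : {rmorphism algC -> algC}) e x :
  (e %| x)%A -> (nu e %| nu x)%A.
Proof.
by move=> /dvdAP[z Az ->]; apply/dvdAP; exists (nu z); rewrite ?Aint_aut ?rmorphM.
Qed.

Lemma Aint_exp n x : (0 < n)%N -> x ^+ n \in Aint -> x \in Aint.
Proof.
move=> n0 /= Axn; apply: (@root_monic_Aint (minCpoly (x ^+ n) \Po 'X^n)).
- by rewrite /root horner_comp hornerXn -/(root _ _) root_minCpoly.
- rewrite monicE lead_coef_comp ?size_polyXn // (monicP (minCpoly_monic _)).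
  by rewrite lead_coefXn expr1n mulr1.
- by rewrite polyOver_comp // rpredX // polyOverX.
Qed.

Lemma Aint_dvdA_exp n e x : (0 < n)%N -> e \in Aint -> (e %| x ^+ n)%A -> x \in Aint.
Proof. by move=> n0 Ae /(Aint_dvdA Ae); apply: Aint_exp. Qed.

Lemma dvdA_nat (m n : nat) : (m%:R%R %| (n%:R%R : algC))%A = (m %| n)%N.
Proof. by rewrite -eqAmod0_nat eqAmod0. Qed.

End AlgebraicIntegers.

(** * Frobenius congruences and polynomial expressions *)

Section Frobenius.

Variable p : nat.
Hypothesis p_pr : prime p.

Lemma eqAmod_exprD : {in Aint &, forall x y : algC,
  ((x + y) ^+ p == x ^+ p + y ^+ p %[mod p%:R%R])%A}.
Proof.
move=> x y Ax Ay /=.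
rewrite -(prednK (prime_gt0 p_pr)) exprDn big_ord_recl big_ord_recr /=.
rewrite !subn0 subnn !expr0 mulr1 mul1r bin0 binn !mulr1n /bump /= add1n.
rewrite prednK ?prime_gt0 // /eqAmod opprD addrACA subrr add0r addrK.
rewrite rpred_sum // => i _.
rewrite -mulr_natl; apply: dvdA_mulr; first by rewrite rpredM ?rpredX.
by rewrite dvdA_nat prime_dvd_bin // add1n /= -ltn_predRL.
Qed.

Lemma eqAmod_expr_sum n (F : 'I_n -> algC) : (forall i, F i \in Aint) ->
  ((\sum_i F i) ^+ p == \sum_i F i ^+ p %[mod p%:R%R])%A.
Proof.
move=> AF; pose P (a b : algC) := a \in Aint /\ (a ^+ p == b %[mod p%:R%R])%A.
suff []: P (\sum_i F i) (\sum_i F i ^+ p) by [].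
apply: (big_ind2 P) => [|a b a' b' [Aa E] [Aa' E']|i _]; last by [].
  by split; rewrite // expr0n -[p == 0]negbK -lt0n prime_gt0.
split; first by rewrite rpredD.
exact: eqAmod_trans (eqAmod_exprD Aa Aa') (eqAmodD E E').
Qed.

Variable nu : {rmorphism algC -> algC}.
Hypothesis p_odd : odd p.

(** The algebraic integers on which [nu] acts as the Frobenius modulo p. They form a subring, so the
    congruence holds on all of Z[u] once it holds at u. *)
Definition frob : {pred algC} :=
  fun y => (y \in Aint) && (y ^+ p == nu y %[mod p%:R%R])%A.

Lemma frobP y : reflect (y \in Aint /\ (y ^+ p == nu y %[mod p%:R%R])%A) (y \in frob).
Proof. exact: andP. Qed.

Lemma frob_subring : subring_closed frob.
Proof.
split=> [|x y /frobP[Ax Ex] /frobP[Ay Ey]|x y /frobP[Ax Ex] /frobP[Ay Ey]].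
- by apply/frobP; rewrite expr1n rmorph1.
- apply/frobP; split; first by rewrite rpredB.
  apply: eqAmod_trans (eqAmod_exprD Ax _) _; first by rewrite rpredN.
  by rewrite rmorphB eqAmodD // exprNn -signr_odd p_odd mulN1r eqAmodN opprK.
- apply/frobP; split; first by rewrite rpredM.
  by rewrite exprMn rmorphM eqAmodM ?rpredX // Aint_aut.
Qed.

End Frobenius.

Section PolyIn.

(** Plays the role of Z[u] for [S = Num.int] and of the field Q(u) for [S = Crat], without building
    either as a type. *)
Definition poly_in (S : {pred algC}) (u y : algC) : Prop :=
  exists2 q : {poly algC}, q \is a polyOver S & y = q.[u].

Section Ring.
Variable S : subringClosed algC.
Implicit Types u x y : algC.

Lemma poly_inC u c : c \in S -> poly_in S u c.
Proof. by exists c%:P; rewrite ?polyOverC ?hornerC. Qed.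

Lemma poly_inX u : poly_in S u u.
Proof. by exists 'X; rewrite ?polyOverX ?hornerX. Qed.

Lemma poly_inB u x y : poly_in S u x -> poly_in S u y -> poly_in S u (x - y).
Proof.
by move=> [q Sq ->] [q' Sq' ->]; exists (q - q'); rewrite ?rpredB // !hornerE.
Qed.

Lemma poly_inM u x y : poly_in S u x -> poly_in S u y -> poly_in S u (x * y).
Proof.
by move=> [q Sq ->] [q' Sq' ->]; exists (q * q'); rewrite ?rpredM // !hornerE.
Qed.

Lemma poly_in_nat u n : poly_in S u n%:R.
Proof. exact/poly_inC/rpred_nat. Qed.

Lemma poly_in_int u (c : int) : poly_in S u c%:~R.
Proof. exact/poly_inC/rpred_int. Qed.

Lemma poly_in0 u : poly_in S u 0. Proof. by apply/poly_inC/rpred0. Qed.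
Lemma poly_in1 u : poly_in S u 1. Proof. by apply/poly_inC/rpred1. Qed.

Lemma poly_inN u x : poly_in S u x -> poly_in S u (- x).
Proof. by rewrite -sub0r; apply/poly_inB/poly_in0. Qed.

Lemma poly_inD u x y : poly_in S u x -> poly_in S u y -> poly_in S u (x + y).
Proof. by move=> ux uy; rewrite -[y]opprK; apply/poly_inB/poly_inN. Qed.

Lemma poly_in_sum u (I : Type) (s : seq I) (P : pred I) (F : I -> algC) :
  (forall i, P i -> poly_in S u (F i)) -> poly_in S u (\sum_(i <- s | P i) F i).
Proof. by move=> uF; elim/big_ind: _ => //; [apply: poly_in0 | apply: poly_inD]. Qed.

Lemma poly_in_prod u (I : Type) (s : seq I) (P : pred I) (F : I -> algC) :
  (forall i, P i -> poly_in S u (F i)) -> poly_in S u (\prod_(i <- s | P i) F i).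
Proof. by move=> uF; elim/big_ind: _ => //; [apply: poly_in1 | apply: poly_inM]. Qed.

Lemma poly_inXn u x n : poly_in S u x -> poly_in S u (x ^+ n).
Proof.
by move=> ux; elim: n => [|n IH]; [apply: poly_in1 | rewrite exprS; apply: poly_inM].
Qed.

Lemma poly_in_trans u v y : poly_in S u v -> poly_in S v y -> poly_in S u y.
Proof.
move=> uv [q Sq ->]; rewrite horner_coef; apply: poly_in_sum => i _.
by apply: poly_inM (poly_inXn _ uv); apply: poly_inC; apply: (polyOverP Sq).
Qed.

End Ring.

Lemma poly_in_int_closed (T : {pred algC}) u y :
  subring_closed T -> u \in T -> poly_in Num.int u y -> y \in T.
Proof.
move=> rT Tu [q Zq ->].
(* [T] is a subring only through the hypothesis [rT], so the structure expected by [rpred_horner] is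
   packed locally. *)
pose Tm := GRing.isSubringClosed.Build _ _ rT.
pose TC : subringClosed _ := HB.pack T Tm.
apply: (@rpred_horner _ TC) => //; apply: polyOverS Zq => _ /intrP[c ->].
exact: (rpred_int TC).
Qed.

Lemma poly_in_Aint u y : u \in Aint -> poly_in Num.int u y -> y \in Aint.
Proof. exact: poly_in_int_closed Aint_subring. Qed.

Lemma poly_in_int_Crat u y : poly_in Num.int u y -> poly_in Crat u y.
Proof. move=> [q Zq ->]; exists q => //; apply: polyOverS Zq => _ /intrP[m ->].
exact: rpred_int. Qed.

Lemma poly_in_aut (nu : {rmorphism algC -> algC}) (q : {poly algC}) u :
  q \is a polyOver Crat -> nu q.[u] = q.[nu u].
Proof.
move=> Qq; rewrite -horner_map; congr _.[_].
by apply/polyP => i; rewrite coef_map; apply/aut_Crat/(polyOverP Qq).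
Qed.

Lemma eq_poly_in (nu mu : {rmorphism algC -> algC}) u y :
  nu u = mu u -> poly_in Crat u y -> nu y = mu y.
Proof. by move=> E [q Qq ->]; rewrite !poly_in_aut // E. Qed.

Lemma poly_in_aut_closed (nu : {rmorphism algC -> algC}) u y :
  poly_in Crat u (nu u) -> poly_in Crat u y -> poly_in Crat u (nu y).
Proof.
move=> unu [q Qq ->]; rewrite poly_in_aut //.
by apply: (poly_in_trans unu); exists q.
Qed.

Lemma Crat_span_poly_in u n y :
  y \in Crat_span (mkseq (fun i => u ^+ i) n) -> poly_in Crat u y.
Proof.
case/Crat_spanP => a ->; apply: poly_in_sum => i _.
apply: poly_inM; first exact/poly_inC/Crat_rat.
rewrite nth_mkseq; last by rewrite -[X in (_ < X)%N](size_mkseq (fun i => u ^+ i) n).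
exact: (poly_inXn _ (poly_inX _ _)).
Qed.

Lemma Crat_span_horner u n (q : {poly algC}) :
  (size q <= n)%N -> q \is a polyOver Crat ->
  q.[u] \in Crat_span (mkseq (fun i => u ^+ i) n).
Proof.
move=> sq Qq; rewrite horner_coef rpred_sum // => i _.
apply: Crat_spanM; first exact: (polyOverP Qq).
apply: mem_Crat_span; apply/mapP; exists (i : nat) => //.
by rewrite mem_iota /= (leq_trans (ltn_ord i) sq).
Qed.

(** Exponents are reduced modulo n, so n powers suffice although they are not independent; no
    minimal polynomial is involved. *)
Lemma poly_in_unity_Crat_span u n y : n.-primitive_root u ->
  y \in Crat_span (mkseq (fun i => u ^+ i) n) <-> poly_in Crat u y.
Proof.
move=> u_pr; split; first exact: Crat_span_poly_in.
move=> [q Qq ->]; rewrite horner_coef rpred_sum // => i _.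
apply: Crat_spanM; first exact: (polyOverP Qq).
apply: mem_Crat_span; apply/mapP; exists (i %% n)%N; last by rewrite prim_expr_mod.
by rewrite mem_iota /= ltn_pmod // (prim_order_gt0 u_pr).
Qed.

Lemma Cint_span_ind (C : algC -> Prop) s :
  C 0 -> (forall y y', C y -> C y' -> C (y + y')) ->
  (forall (c : int) y, y \in s -> C (c%:~R * y)) ->
  forall y, y \in Cint_span s -> C y.
Proof.
move=> C0 CD CM _ /(Cint_spanP (in_tuple s))[a ->].
elim/big_ind: _ => // i _; rewrite -mulrzl; apply: CM.
exact: mem_nth.
Qed.

Lemma Cint_spanM s a y : a \in Num.int -> y \in Cint_span s -> a * y \in Cint_span s.
Proof. by move=> /intrP[m ->] sy; rewrite mulrzl rpredMz. Qed.

Lemma poly_in_Cint_span u n y :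
  y \in Cint_span (mkseq (fun i => u ^+ i) n) -> poly_in Num.int u y.
Proof.
move/(Cint_spanP (in_tuple _)) => [a ->]; apply: poly_in_sum => i _.
rewrite -mulrzl; apply: poly_inM; first exact/poly_inC/intr_int.
rewrite nth_mkseq; last by rewrite -[X in (_ < X)%N](size_mkseq (fun i => u ^+ i) n).
exact: (poly_inXn _ (poly_inX _ _)).
Qed.

End PolyIn.

(** * The real subfield of the 2-power cyclotomic field *)

Section TwoPowerCyclotomic.

Variables (e : nat) (w : algC).
Let k := (2 ^ e)%N.
Hypothesis e_gt0 : (0 < e)%N.
Hypothesis w_pr : (4 * k).-primitive_root w.

Let t : algC := w + w^-1.
Let eta : algC := 2 - t.

(* The Dirichlet kernel u^(-j) + u^(1-j) + ... + u^j. *)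
Definition dirichlet (u : algC) (j : nat) : algC := (u ^+ j.+1 - u ^- j) / (u - 1).
Let f := dirichlet w.

Let k_gt0 : (0 < k)%N. Proof. by rewrite expn_gt0. Qed.
Let w0 : w != 0.
Proof. by rewrite (prim_root_eq0 w_pr) muln_eq0 /= -lt0n. Qed.

Lemma expr_prim_half : w ^+ (2 * k) = -1.
Proof.
have /eqP := prim_expr_order w_pr.
rewrite (_ : 4 * k = 2 * k * 2)%N; last by rewrite mulnAC.
rewrite exprM sqrf_eq1 => /orP[|/eqP//].
rewrite -(prim_order_dvd w_pr) => /dvdn_leq.
by rewrite muln_gt0 k_gt0 leq_pmul2r // => /(_ isT).
Qed.

Let w1 : w - 1 != 0.
Proof.
rewrite subr_eq0 -[w]expr1 -(prim_order_dvd w_pr) dvdn1.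
by rewrite -(prednK k_gt0) mulnS.
Qed.

Let fE j : f j * (w - 1) = w ^+ j.+1 - w ^- j.
Proof. by rewrite divfK. Qed.

Let f0 : f 0 = 1.
Proof. by rewrite /f /dirichlet expr1 expr0 invr1 divff. Qed.

Let f1 : f 1 = t + 1.
Proof. by apply: (mulIf w1); rewrite fE /t expr1; field; exact: w0. Qed.

Let fSS j : f j.+2 = t * f j.+1 - f j.
Proof.
apply: (mulIf w1); rewrite mulrBl -[t * _ * _]mulrA !fE /t !exprS.
have: w ^+ j != 0 by rewrite expf_neq0.
by move: (w ^+ j) => a a0; field; rewrite w0 a0.
Qed.

(** The boundary relation, due to [w^(2k) = -1]. It stands in for the minimal polynomial of [t]:
    with the recurrence [fSS] it makes the span of f_0, ..., f_(k-1) stable under multiplication by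
    [t]. *)
Let fk : f k = f k.-1.
Proof.
apply: (mulIf w1); rewrite !fE prednK //.
have wk : w ^+ k * w ^+ k = -1 by rewrite -exprD addnn -mul2n expr_prim_half.
have wk0 : w ^+ k != 0 by rewrite expf_neq0.
have -> : w ^- k = - w ^+ k by apply: (mulfI wk0); rewrite divff // mulrN wk opprK.
have -> : w ^- k.-1 = - w ^+ k.+1.
  apply: (mulfI (expf_neq0 k.-1 w0)); rewrite divff ?expf_neq0 //.
  by rewrite mulrN -exprD addnS -addSn prednK // exprD wk opprK.
by rewrite !opprK addrC.
Qed.

(** The size bound is there for [inL], which allows only the first 2^m powers of theta. *)
Lemma dirichlet_poly_in (S : subringClosed algC) j :
  exists q : {poly algC}, [/\ q \is a polyOver S, (size q <= j.+1)%N & f j = q.[t]].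
Proof.
elim/ltn_ind: j => [[|[|j]]] IH.
- by exists 1; split; [exact: rpred1 | rewrite size_poly1 | rewrite hornerE].
- exists ('X + 1); split; last by rewrite !hornerE f1.
    by apply: rpredD; [exact: polyOverX | exact: rpred1].
  by rewrite size_polyDl ?size_polyX ?size_poly1.
have [q [Zq sq qE]] := IH j.+1 (ltnSn _).
have [q' [Zq' sq' qE']] := IH j (ltnW (ltnSn _)).
exists ('X * q - q'); rewrite !hornerE -qE -qE' fSS; split=> //.
  by rewrite rpredB // rpredM // polyOverX.
rewrite (leq_trans (size_polyD _ _)) // geq_max size_polyN.
rewrite (leq_trans sq') ?andbT //; last by rewrite leqW.
apply: leq_trans (size_polyMleq _ _) _.
by rewrite size_polyX.
Qed.

Lemma poly_in_dirichlet (S : subringClosed algC) j : poly_in S t (f j).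
Proof. by have [q [Sq _ ->]] := dirichlet_poly_in S j; exists q. Qed.

Definition dirichlet_span (S : {pred algC}) (y : algC) : Prop :=
  exists2 d : 'I_k -> algC, forall j, d j \in S & y = \sum_j d j * f j.

Section Span.
Variable S : subringClosed algC.

Let spanD x y : dirichlet_span S x -> dirichlet_span S y -> dirichlet_span S (x + y).
Proof.
move=> [d Sd ->] [d' Sd' ->]; exists (fun j => d j + d' j) => [j|].
  by rewrite rpredD.
by rewrite -big_split; apply: eq_bigr => j _; rewrite mulrDl.
Qed.

Let spanZ a x : a \in S -> dirichlet_span S x -> dirichlet_span S (a * x).
Proof.
move=> Sa [d Sd ->]; exists (fun j => a * d j) => [j|]; first by rewrite rpredM.
by rewrite mulr_sumr; apply: eq_bigr => j _; rewrite mulrA.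
Qed.

Let span_sum (I : Type) (s : seq I) (F : I -> algC) :
  (forall i, dirichlet_span S (F i)) -> dirichlet_span S (\sum_(i <- s) F i).
Proof.
move=> sF; elim/big_ind: _ => //; exists (fun=> 0) => [j|]; first exact: rpred0.
by rewrite big1 // => j _; rewrite mul0r.
Qed.

Let span_f j : (j <= k)%N -> dirichlet_span S (f j).
Proof.
wlog jk : j / (j < k)%N => [IH|_].
  rewrite leq_eqVlt => /predU1P[->|jk]; last by apply: IH; rewrite // ltnW.
  by rewrite fk; apply: IH; rewrite ?leq_pred // prednK.
exists (fun i => (i == Ordinal jk)%:R) => [i|]; first exact: rpred_nat.
rewrite (bigD1 (Ordinal jk)) //= eqxx mul1r big1 ?addr0 // => i /negbTE->.
by rewrite mul0r.
Qed.

Let span_tf j : (j < k)%N -> dirichlet_span S (t * f j).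
Proof.
case: j => [_|j jk].
  have -> : t * f 0 = f 1 + -1 * f 0 by rewrite f0 f1 mulr1 mulr1 addrK.
  by apply/spanD/spanZ/span_f => //; [apply: span_f | apply: rpredN1].
have -> : t * f j.+1 = f j.+2 + f j by rewrite fSS subrK.
by apply: spanD; apply: span_f => //; lia.
Qed.

Lemma poly_in_dirichlet_span y : poly_in S t y -> dirichlet_span S y.
Proof.
move=> [q Sq ->]; rewrite horner_coef; apply: span_sum => i.
apply: spanZ; first exact: (polyOverP Sq).
elim: {i}(i : nat) => [|i [d Sd E]]; first by rewrite expr0 -f0; apply: span_f.
rewrite exprS E mulr_sumr; apply: span_sum => j.
by rewrite mulrCA; apply/spanZ/span_tf/ltn_ord/Sd.
Qed.

End Span.

(** The trace from L to Q of w^i + w^-i, the conjugates of w being represented by the odd exponents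
    below 2k, one from each pair u, u^-1. *)
Definition bitrace (i : nat) : algC :=
  \sum_(j < k) (w ^+ ((2 * j).+1 * i) + w ^- ((2 * j).+1 * i)).

Let bitrace0 : bitrace 0 = (2 * k)%:R.
Proof.
rewrite /bitrace (eq_bigr (fun=> 2)) => [|j _].
  by rewrite sumr_const card_ord natrM mulr_natr.
by rewrite muln0 expr0 invr1.
Qed.

Let odd_powers_sum (v : algC) : (v ^+ 2 - 1) * (\sum_(j < k) v ^+ (2 * j).+1) = v * (v ^+ (2 * k) - 1).
Proof.
rewrite (eq_bigr (fun j : 'I_k => v * (v ^+ 2) ^+ j)) => [|j _].
  by rewrite -mulr_sumr mulrCA -subrX1 -exprM.
by rewrite exprS exprM.
Qed.

(** With v = w^i, the two halves are the geometric sums v(s - 1)/(v^2 - 1), where s = v^(2k), and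
    the same at v^-1. Since v^(2k) = v^(-2k), they are opposite. *)
Let bitrace_eq0 i : (0 < i < 2 * k)%N -> bitrace i = 0.
Proof.
move=> /andP[i0 ik]; pose v := w ^+ i.
have v0 : v != 0 by rewrite expf_neq0.
have v21 : v ^+ 2 - 1 != 0.
  rewrite subr_eq0 -exprM -(prim_order_dvd w_pr); apply/negP => /dvdn_leq.
  rewrite muln_gt0 i0 => /(_ isT); apply/negP; rewrite -ltnNge.
  by rewrite mulnC (_ : 4 * k = 2 * (2 * k))%N ?ltn_pmul2l // mulnA.
have sE : v ^- (2 * k) = v ^+ (2 * k).
  apply: (mulfI (expf_neq0 (2 * k) v0)); rewrite divff ?expf_neq0 //.
  by rewrite -!exprM mulnC exprM expr_prim_half -exprMn mulrNN mulr1 expr1n.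
apply: (mulfI v21); rewrite mulr0 /bitrace big_split /= mulrDr.
have -> : \sum_(j < k) w ^+ ((2 * j).+1 * i) = \sum_(j < k) v ^+ (2 * j).+1.
  by apply: eq_bigr => j _; rewrite mulnC exprM.
have -> : \sum_(j < k) w ^- ((2 * j).+1 * i) = \sum_(j < k) v^-1 ^+ (2 * j).+1.
  by apply: eq_bigr => j _; rewrite mulnC exprM exprVn.
rewrite (odd_powers_sum v); have := odd_powers_sum v^-1.
rewrite [v^-1 ^+ (2 * k)]exprVn sE.
move: (\sum__ _) (v ^+ (2 * k)) => S s E.
suff -> : (v ^+ 2 - 1) * S = - v ^+ 3 * ((v^-1 ^+ 2 - 1) * S) * v^-1.
  by rewrite E; field; exact: v0.
by field; exact: v0.
Qed.

(** The reason for the weight 2 - theta: it equals -(w - 1)^2 / w and cancels the denominators of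
    both kernels. *)
Let eta_f a b : eta * (f a * f b) =
  w ^+ a / w ^+ b + w ^+ b / w ^+ a - (w ^+ (a + b).+1 + w ^- (a + b).+1).
Proof.
have a0 : w ^+ a != 0 by rewrite expf_neq0.
have b0 : w ^+ b != 0 by rewrite expf_neq0.
have ww0 : (w - 1) ^+ 2 != 0 by rewrite expf_neq0.
apply: (mulIf ww0); rewrite expr2 [f a * _]mulrC.
transitivity (eta * ((f b * (w - 1)) * (f a * (w - 1)))); first by ring.
rewrite !fE /eta /t !exprS exprD.
by move: (w ^+ a) (w ^+ b) a0 b0 => A B A0 B0; field; rewrite B0 A0 w0.
Qed.

Variable rho : nat -> {rmorphism algC -> algC}.
Hypothesis rho_w : forall j, rho j w = w ^+ (2 * j).+1.

Let rho_sum i : \sum_(j < k) rho j (w ^+ i + w ^- i) = bitrace i.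
Proof.
by apply: eq_bigr => j _; rewrite rmorphD fmorphV rmorphXn rho_w -exprM.
Qed.

(** By [eta_f] the sum is [bitrace (b - a) - bitrace (a + b + 1)], and 0 < a + b + 1 < 2k kills the
    second term. *)
Lemma dirichlet_orthonormal a b : (a < k)%N -> (b < k)%N ->
  \sum_(j < k) rho j (eta * (f a * f b)) = (2 * k)%:R * (a == b)%:R.
Proof.
wlog ab : a b / (a <= b)%N => [IH ak bk|ak bk].
  have [/IH->//|/ltnW /IH E] := leqP a b.
  by rewrite [f a * _]mulrC E // eq_sym.
rewrite eta_f.
have -> : w ^+ a / w ^+ b + w ^+ b / w ^+ a = w ^+ (b - a) + w ^- (b - a).
  by rewrite [RHS]addrC expfB_cond ?(negbTE w0) //= invf_div.
rewrite (eq_bigr (fun j : 'I_k => rho j (w ^+ (b - a) + w ^- (b - a)) -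
   rho j (w ^+ (a + b).+1 + w ^- (a + b).+1))) => [|j _]; last by rewrite rmorphB.
rewrite sumrB !rho_sum [bitrace _.+1]bitrace_eq0 ?subr0; last by lia.
have [->|neq] := eqVneq a b; first by rewrite subnn bitrace0 mulr1.
by rewrite bitrace_eq0 ?mulr0 //; lia.
Qed.

(** The diagonal case of [eta_f]. Combined with the norm 2 of [eta], it makes 2 a multiple of eta^k
    inside Z[t]. *)
Lemma rho_eta j : rho j eta = eta * f j ^+ 2.
Proof.
rewrite expr2 eta_f !divff ?expf_neq0 // addnn -mul2n.
by rewrite /eta /t rmorphB rmorph_nat rmorphD fmorphV rho_w.
Qed.

Let odd_ndvd j : ~~ (4 * k %| (2 * j).+1)%N.
Proof.
apply/negP => /(dvdn_trans (dvdn_mulr k (isT : 2 %| 4)%N)).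
by rewrite dvdn2 /= oddM.
Qed.

Lemma rho_eta_gt0 j : 0 < rho j eta.
Proof.
pose u := w ^+ (2 * j).+1.
have nw : `|u| = 1.
  rewrite normrX (_ : `|w| = 1) ?expr1n //; apply/eqP.
  rewrite -(@pexpr_eq1 _ _ (4 * k)) ?normr_ge0 ?muln_gt0 //.
  by rewrite -normrX (prim_expr_order w_pr) normr1.
have -> : rho j eta = `|1 - u| ^+ 2.
  have uc : u^* = u^-1 by rewrite invC_norm nw expr1n invr1 mul1r.
  have -> : `|1 - u| ^+ 2 = (1 - u) * (1 - u^-1) by rewrite normCK -uc rmorphB rmorph1.
  rewrite /eta /t rmorphB rmorph_nat rmorphD fmorphV rho_w -/u.
  by field; rewrite -normr_eq0 nw oner_eq0.
rewrite exprn_gt0 // normr_gt0 subr_eq0 eq_sym -(prim_order_dvd w_pr).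
exact: odd_ndvd.
Qed.

Lemma prod_rho_eta : \prod_(j < k) rho j eta = 2.
Proof.
pose rs := mkseq (fun j => w ^+ (2 * j).+1) (2 * k).
have k20 : (0 < 2 * k)%N by rewrite muln_gt0.
have E : 'X^(2 * k) + 1 = \prod_(z <- rs) ('X - z%:P).
  rewrite [LHS](@all_roots_prod_XsubC _ _ rs).
  - by rewrite (monicP (monicXnaddC 1 k20)) scale1r.
  - by rewrite size_XnaddC // size_mkseq.
  - apply/allP => _ /mapP[j _ ->].
    rewrite /root !hornerE -exprM mulnC exprM expr_prim_half.
    by rewrite -signr_odd /= oddM /= expr1 addNr.
  rewrite uniq_rootsE map_inj_in_uniq ?iota_uniq // => a b.
  rewrite !mem_iota /= => ak bk /eqP; rewrite (eq_prim_root_expr w_pr).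
  by rewrite !modn_small; [move/eqP | | ]; lia.
have -> : 2 = \prod_(z <- rs) (1 - z).
  have <- : ('X^(2 * k) + 1).[1] = 2 :> algC by rewrite !hornerE expr1n.
  by rewrite E horner_prod; apply: eq_bigr => z _; rewrite !hornerE.
rewrite big_map (_ : iota 0 _ = index_iota 0 (2 * k)); last by rewrite /index_iota subn0.
rewrite big_mkord.
(* The root u = w^(2j+1) is paired with u^-1 = w^(4k-2j-1): (1 - u)(1 - u^-1) is the j-th conjugate
   of [eta]. *)
rewrite mul2n -addnn big_split_ord /= [X in _ = _ * X](reindex_inj rev_ord_inj) /=.
rewrite -big_split /=; apply: eq_bigr => j _.
have -> : w ^+ (2 * (k + (k - j.+1))).+1 = w ^- (2 * j).+1.
  apply: (mulfI (expf_neq0 (2 * j).+1 w0)); rewrite divff ?expf_neq0 // -exprD.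
  rewrite (_ : _ + _ = 4 * k)%N ?(prim_expr_order w_pr) //.
  by have := ltn_ord j; lia.
rewrite /eta /t rmorphB rmorph_nat rmorphD fmorphV rho_w.
by field; rewrite expf_neq0.
Qed.


(** * Total ramification of 2 in L, and O_L = Z[theta] *)

Let eta_pow_dvd2 : exists2 g, poly_in Num.int t g & 2 = eta ^+ k * g.
Proof.
exists (\prod_(j < k) f j ^+ 2); first by apply: poly_in_prod => j _; apply/poly_inXn/poly_in_dirichlet.
rewrite -prod_rho_eta (eq_bigr (fun j : 'I_k => eta * f j ^+ 2)) => [|j _].
  by rewrite big_split /= prodr_const card_ord.
exact: rho_eta.
Qed.

(** Repeated squaring gives eta^(2^i) = w^(2^i) + w^(-2^i) modulo 2; at i = e the right side is w^k
    + w^-k = 0. *)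
Let dvd2_eta_pow : exists2 h, poly_in Num.int t h & eta ^+ k = 2 * h.
Proof.
suff [r [Zr E _]] : exists r, [/\ poly_in Num.int t r,
    eta ^+ (2 ^ e) = w ^+ (2 ^ e) + w ^- (2 ^ e) + 2 * r &
    poly_in Num.int t (w ^+ (2 ^ e) + w ^- (2 ^ e))].
  exists r; rewrite // E -/k (_ : w ^- k = - w ^+ k) ?subrr ?add0r //.
  apply: (mulfI (expf_neq0 k w0)); rewrite divff ?expf_neq0 //.
  by rewrite mulrN -exprD addnn -mul2n expr_prim_half opprK.
have Z2 : poly_in Num.int t 2 by apply/poly_in_nat.
elim: e => [|i [r [Zr E Zs]]].
  exists (1 - t); rewrite !expr1; split; last exact: poly_inX.
    exact/poly_inB/poly_inX/poly_in1.
  by rewrite /eta /t; ring.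
rewrite expnSr !exprM E; move: (w ^+ (2 ^ i)) (expf_neq0 (2 ^ i) w0) Zs => a a0 Zs.
exists (1 + 2 * (a + a^-1) * r + 2 * r ^+ 2); split.
- apply: poly_inD; first apply: poly_inD; first exact: poly_in1.
    by apply: poly_inM => //; apply: poly_inM.
  by apply: poly_inM => //; apply: poly_inXn.
- by field.
have -> : a ^+ 2 + a ^- 2 = (a + a^-1) ^+ 2 - 2 by field.
by apply: poly_inB => //; apply: poly_inXn.
Qed.

Let w_Aint : w \in Aint. Proof. exact: Aint_prim_root w_pr. Qed.

Let t_Aint : t \in Aint.
Proof.
rewrite rpredD //; have k40 : (0 < 4 * k)%N by rewrite muln_gt0.
by apply/(Aint_unity_root k40)/unity_rootP; rewrite exprVn (prim_expr_order w_pr) invr1.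
Qed.

Let eta_Aint : eta \in Aint. Proof. by rewrite rpredB // (Aint_Cnat (rpred_nat _ 2)). Qed.

Let poly_in_eta_split v : poly_in Num.int t v ->
  exists (c : int) (v' : algC), poly_in Num.int t v' /\ v = c%:~R + eta * v'.
Proof.
have Zeta : poly_in Num.int t eta by apply/poly_inB/poly_inX/poly_in_nat.
have teta : poly_in Num.int eta t.
  rewrite (_ : t = 2 - eta); last by rewrite opprB addrC subrK.
  by apply/poly_inB/poly_inX/poly_in_nat.
case/(poly_in_trans teta) => q Zq ->; rewrite horner_coef.
case: (size q) => [|n]; first by exists 0, 0; rewrite big_ord0 mulr0 addr0; split; first exact: poly_in0.
have /intrP[c cE] : q`_0 \in Num.int := polyOverP Zq 0.
exists c, (\sum_(i < n) q`_i.+1 * eta ^+ i); split.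
  apply: poly_in_sum => i _; apply: poly_inM (poly_inXn _ Zeta).
  by apply: poly_inC; apply: (polyOverP Zq).
rewrite big_ord_recl expr0 mulr1 cE mulr_sumr; congr (_ + _).
by apply: eq_bigr => i _; rewrite exprS mulrCA.
Qed.

(* Divide v by eta repeatedly: an odd constant term at any of the k steps would
   make eta divide 1, and after k steps eta^k absorbs the denominator 2. *)
Let poly_in_half v : poly_in Num.int t v -> (2%N%:R%R %| v)%A -> poly_in Num.int t (v / 2).
Proof.
move=> Zv /dvdAP[u Au vE].
have [g Zg gE] := eta_pow_dvd2; have [h Zh hE] := dvd2_eta_pow.
have eta0 : eta != 0.
  by apply/eqP => E; move/eqP: gE; rewrite E expr0n /= -[k == 0%N]negbK -lt0n k_gt0 mul0r pnatr_eq0.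
suff [v' Zv' ->] : exists2 v', poly_in Num.int t v' & v = eta ^+ k * v'.
  by rewrite hE mulrAC [2 * h]mulrC mulfK ?pnatr_eq0 //; apply: poly_inM.
suff /(_ k (leqnn k)) : forall i, (i <= k)%N ->
  exists2 v', poly_in Num.int t v' & v = eta ^+ i * v' by [].
elim=> [|i IH] ik; first by exists v; rewrite ?mul1r.
have [v' Zv' v'E] := IH (ltnW ik).
have [c [v2 [Zv2 v2E]]] := poly_in_eta_split Zv'.
have ki : eta ^+ k = eta * eta ^+ (k - i.+1) * eta ^+ i.
  by rewrite -exprS -exprD; congr (_ ^+ _); lia.
have Zeta : poly_in Num.int t eta by apply/poly_inB/poly_inX/poly_in_nat.
have two_eta : 2 = eta * (eta ^+ k.-1 * g) by rewrite mulrA -exprS prednK.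
have two_etaz : 2%Z%:~R = eta * (eta ^+ k.-1 * g) by exact: two_eta.
pose q := (c %/ 2)%Z; have cE := divz_eq c 2.
have : 0 <= (c %% 2)%Z < 2 by rewrite modz_ge0 ?ltz_pmod.
case: (c %% 2)%Z cE => [[|[|//]]|//] cE _.
  exists (eta ^+ k.-1 * g * q%:~R + v2).
    apply/poly_inD/Zv2/poly_inM/poly_in_int; apply: poly_inM => //; exact: poly_inXn.
  rewrite v'E v2E cE addr0 intrM two_etaz.
  by rewrite -/q exprSr; ring.
exfalso.
have v'c : (eta %| v')%A.
  apply/dvdAP; exists (eta ^+ (k - i.+1) * g * u).
    by rewrite !rpredM ?rpredX //; apply: poly_in_Aint Zg.
  apply: (mulfI (expf_neq0 i eta0)); rewrite -v'E vE [2%:R]gE ki; ring.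
have eta1 : (eta %| 1)%A.
  have -> : 1 = v' - eta * v2 - 2 * q%:~R.
    by rewrite v2E cE intrD intrM -/q; ring.
  apply: rpredB; first apply: rpredB => //.
    by rewrite dvdA_mulr ?dvdA_refl //; apply: poly_in_Aint Zv2.
  apply: dvdA_mulr; first exact: Aint_int.
  rewrite two_eta dvdA_mulr ?dvdA_refl // rpredM ?rpredX //.
  exact: poly_in_Aint Zg.
have := dvdA_exp k eta1; rewrite expr1n hE => /dvdAP[y Ay E].
have : (2%:R%R %| 1%N%:R%R)%A.
  by apply/dvdAP; exists (y * h); [rewrite rpredM // (poly_in_Aint t_Aint) | rewrite -mulrA [h * _]mulrC -E].
by rewrite dvdA_nat.
Qed.

(* Traces against the basis f_j bound the denominators by 2k, a power of 2. *)
Lemma Aint_poly_in_real_2power y :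
  y \in Aint -> poly_in Crat t y -> poly_in Num.int t y.
Proof.
move=> Ay Qy; have [d Qd yE] := poly_in_dirichlet_span Qy.
have Zd j : (2 * k)%:R * d j \in Num.int.
  apply: Cint_rat_Aint; first by rewrite rpredM ?rpred_nat.
  suff -> : (2 * k)%:R * d j = \sum_(i < k) rho i (eta * (y * f j)).
    by rewrite rpred_sum // => i _; rewrite Aint_aut rpredM // rpredM // (poly_in_Aint t_Aint (poly_in_dirichlet _ _)).
  rewrite (eq_bigr (fun i : 'I_k => \sum_(a < k) d a * rho i (eta * (f a * f j)))).
    rewrite exchange_big (bigD1 j) //= -mulr_sumr dirichlet_orthonormal //.
    rewrite eqxx mulr1 mulrC big1 ?addr0 // => a /negbTE aj.
    by rewrite -mulr_sumr dirichlet_orthonormal // (_ : (a == j :> nat) = false) // !mulr0.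
  move=> i _; rewrite yE mulr_suml mulr_sumr rmorph_sum; apply: eq_bigr => a _.
  by rewrite -[X in X * rho _ _](aut_Crat (rho i) (Qd a)) -rmorphM; congr (rho i _); ring.
have: poly_in Num.int t ((2 ^ e.+1)%:R * y).
  rewrite expnS -/k yE mulr_sumr; apply: poly_in_sum => j _; rewrite mulrA.
  apply: poly_inM; last exact: poly_in_dirichlet.
  by apply: poly_inC; apply: Zd.
elim: e.+1 => [|i IH]; first by rewrite mul1r.
move=> Z; apply: IH; have := poly_in_half Z.
rewrite expnS natrM -mulrA [2%:R * _]mulrC mulfK ?pnatr_eq0 //; apply.
by apply: dvdA_mull; rewrite ?dvdA_refl // rpredM // Aint_Cnat.
Qed.

End TwoPowerCyclotomic.

(** * Sums over powers of a primitive root *)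

Section IterMorphism.

Variables (R : pzRingType) (n : nat) (f : {rmorphism R -> R}).

Lemma iter_is_zmod_morphism : zmod_morphism (iter n f).
Proof. by elim: n => [|i IH] x y //=; rewrite IH rmorphB. Qed.

Lemma iter_is_monoid_morphism : monoid_morphism (iter n f).
Proof.
by split=> [|x y]; elim: n => [|i IH] //=; rewrite IH ?rmorph1 ?rmorphM.
Qed.

HB.instance Definition _ := GRing.isZmodMorphism.Build R R (iter n f) iter_is_zmod_morphism.
HB.instance Definition _ := GRing.isMonoidMorphism.Build R R (iter n f) iter_is_monoid_morphism.

End IterMorphism.

Section BigPeriodic.

Variables (T : Type) (idx : T) (op : Monoid.com_law idx).

Lemma big_ord_shift h (F : nat -> T) j : (forall i, F (i + h)%N = F i) ->
  \big[op/idx]_(i < h) F (i + j)%N = \big[op/idx]_(i < h) F i.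
Proof.
move=> Fh; elim: j => [|j <-]; first by apply: eq_bigr => i _; rewrite addn0.
case: h Fh => [|h] Fh; first by rewrite !big_ord0.
rewrite big_ord_recr big_ord_recl /= Monoid.mulmC; congr (op _ _).
  by rewrite -(Fh j) addnC addSnnS.
by apply: eq_bigr => i _; rewrite /bump /= add1n addSnnS.
Qed.

Lemma big_ord_mul h l (F : nat -> T) :
  \big[op/idx]_(q < h * l) F q = \big[op/idx]_(j < h) \big[op/idx]_(s < l) F (j * l + s)%N.
Proof.
elim: h => [|h IH]; first by rewrite mul0n !big_ord0.
by rewrite mulSnr big_split_ord big_ord_recr IH.
Qed.

End BigPeriodic.

Section PrimitiveRoot.

Variables (p r : nat).
Hypotheses (p_pr : prime p) (r_prim : (p.-1).-primitive_root (r%:R : 'F_p)).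

Let p0 : (0 < p)%N := prime_gt0 p_pr.

Lemma eqn_mod_exp s t : (r ^ s == r ^ t %[mod p])%N = (s == t %[mod p.-1])%N.
Proof.
rewrite -(eq_prim_root_expr r_prim) -!natrX -val_eqE /=.
by rewrite !val_Fp_nat.
Qed.

Lemma perm_exp_mod :
  perm_eq [seq (r ^ s %% p)%N | s <- iota 0 p.-1] (iota 1 p.-1).
Proof.
have us : uniq [seq (r ^ s %% p)%N | s <- iota 0 p.-1].
  rewrite map_inj_in_uniq ?iota_uniq // => s t; rewrite !mem_iota /= => sp tp.
  by move/eqP; rewrite eqn_mod_exp !modn_small // => /eqP.
rewrite uniq_perm ?iota_uniq //.
case: (@uniq_min_size _ _ (iota 1 p.-1) us) => //; last by rewrite size_map !size_iota.
move=> _ /mapP[s _ ->]; rewrite mem_iota add1n (prednK p0) ltn_pmod //.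
rewrite andbT lt0n; apply/negP => /eqP rs0.
have := prim_root_eq0 r_prim; rewrite -[p.-1 == 0]negbK -lt0n (prim_order_gt0 r_prim).
have : (r%:R : 'F_p) ^+ s == 0 by rewrite -natrX -val_eqE /= val_Fp_nat // rs0.
by rewrite expf_eq0 => /andP[_ ->].
Qed.

Lemma big_exp_mod (T : Type) (idx : T) (op : Monoid.com_law idx) (F : nat -> T) :
  (forall i, F (i %% p)%N = F i) ->
  \big[op/idx]_(s < p.-1) F (r ^ s)%N = \big[op/idx]_(1 <= i < p) F i.
Proof.
move=> Fp; rewrite (_ : index_iota 1 p = iota 1 p.-1); last by rewrite /index_iota subn1.
rewrite -(perm_big _ perm_exp_mod) big_map.
rewrite -(big_mkord xpredT (fun s => F (r ^ s)%N)) /index_iota subn0.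
by apply: eq_bigr => i _; rewrite Fp.
Qed.

Lemma exp_mod_surj a : ~~ (p %| a)%N -> exists s, (a == r ^ s %[mod p])%N.
Proof.
move=> pa; have : (a %% p)%N \in iota 1 p.-1.
  by rewrite mem_iota add1n (prednK p0) ltn_pmod // lt0n pa.
by rewrite -(perm_mem perm_exp_mod) => /mapP[s _ ->]; exists s.
Qed.

Hypothesis p_odd : odd p.

(** In F_p, r^((p-1)/2) is a square root of 1 other than 1, hence -1; since p is odd, [p./2] is
    (p-1)/2. *)
Lemma dvdn_exp_add1 s : (p %| (r ^ s).+1)%N = (s == p./2 %[mod p.-1])%N.
Proof.
have p2 : p.-1 = (p./2).*2.
  by rewrite -[in LHS](odd_double_half p) p_odd.
have half0 : (0 < p./2)%N by rewrite -double_gt0 -p2 (prim_order_gt0 r_prim).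
have E : (r%:R : 'F_p) ^+ p./2 = -1.
  have /eqP := prim_expr_order r_prim; rewrite p2 -muln2 exprM sqrf_eq1.
  case/orP => /eqP // /eqP; rewrite -(prim_order_dvd r_prim) p2 => /dvdn_leq.
  by rewrite half0 -addnn => /(_ isT); rewrite -[X in (_ <= X)%N]addn0 leq_add2l leqNgt half0.
rewrite -(eq_prim_root_expr r_prim) E -addr_eq0 -natrX -(natrD _ _ 1) addn1.
by rewrite -val_eqE /= val_Fp_nat.
Qed.

End PrimitiveRoot.

(** * The p-th cyclotomic field *)

Lemma prim_zeta p : prime p -> odd p -> p.-primitive_root (zeta p).
Proof.
move=> p_pr p_odd; have p0 := prime_gt0 p_pr.
have rp : (p.-root (-1) : algC) ^+ p = -1 by rewrite rootCK.
have zp : zeta p ^+ p = 1 by rewrite /zeta -exprM mulnC exprM rp expr2 mulrNN mulr1.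
have [d zd dp] := prim_order_exists p0 zp.
move: (primeP p_pr) => [p1 /(_ d dp)/orP[/eqP d1|/eqP dp1]]; last by move: zd; rewrite dp1.
(* Order 1 would make [p.-root (-1)] equal to 1 or -1. The first has p-th power 1; the second is
   excluded because [p.-root] never takes negative values for p > 1. *)
have /eqP := prim_expr_order zd; rewrite d1 expr1 /zeta sqrf_eq1 => /orP[] /eqP E.
  by move/eqP: rp; rewrite E expr1n -addr_eq0 -(natrD _ 1 1) pnatr_eq0.
by have := @rootC_lt0 algC p (-1) p1; rewrite E oppr_lt0 ltr01.
Qed.

Lemma prim_omega m : (0 < m)%N -> (2 ^ m).-primitive_root (omega m).
Proof.
case: m => // m _; have w1 : omega m.+1 ^+ (2 ^ m) = -1.
  by rewrite /omega subn1 rootCK // expn_gt0.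
have w2 : omega m.+1 ^+ (2 ^ m.+1) = 1.
  by rewrite expnSr exprM w1 expr2 mulrNN mulr1.
have [d wd dp] := prim_order_exists (expn_gt0 2 m.+1) w2.
have /(dvdn_pfactor _ _ (isT : prime 2))[j jm dE] := dp.
have [jm1|] := ltnP j m.+1; last by move=> mj; move: wd; rewrite dE (_ : j = m.+1) //; lia.
have : omega m.+1 ^+ (2 ^ m) = 1.
  apply/eqP; rewrite -(prim_order_dvd wd) dE; apply: dvdn_exp2l; lia.
by rewrite w1 => /eqP; rewrite eq_sym -addr_eq0 -(natrD _ 1 1) pnatr_eq0.
Qed.

Section GaussPeriod.

Variables (p r : nat) (lambda : int) (sigma : {rmorphism algC -> algC}).
Hypotheses (p_pr : prime p) (p_odd : odd p).
Hypothesis r_prim : (p.-1).-primitive_root (r%:R : 'F_p).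
Hypothesis lambda_r : (lambda * (r%:Z - 1) = 1 %[mod p%:Z])%Z.
Hypothesis sigma_zeta : sigma (zeta p) = zeta p ^+ r.

Let z : algC := zeta p.
Let a : algC := z ^ lambda * alpha p r.
Let h := p./2.

Let p0 : (0 < p)%N := prime_gt0 p_pr.
Let z_pr : p.-primitive_root z := prim_zeta p_pr p_odd.
Let z0 : z != 0.
Proof. by rewrite (prim_root_eq0 z_pr) -lt0n. Qed.

Let p2 : p.-1 = h.*2.
Proof. by rewrite -[in LHS](odd_double_half p) p_odd. Qed.

Lemma iter_zeta s : iter s sigma z = z ^+ (r ^ s).
Proof.
elim: s => [|s IH]; first by rewrite expr1.
by rewrite iterS IH rmorphXn /= sigma_zeta -exprM expnS.
Qed.

Let z_half : z ^+ (r ^ h) = z^-1.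
Proof.
apply: (mulfI z0); rewrite divff // -exprS; apply/eqP.
by rewrite -(prim_order_dvd z_pr) (dvdn_exp_add1 p_pr r_prim p_odd) // eqxx.
Qed.

Lemma sum_zeta_exp b : \sum_(s < p.-1) z ^+ (r ^ s * b) = (p * (p %| b))%:R - 1.
Proof.
rewrite (big_exp_mod p_pr r_prim _ (F := fun i => z ^+ (i * b))) => [|i]; last first.
  by apply/eqP; rewrite (eq_prim_root_expr z_pr) modnMml.
have -> : \sum_(1 <= i < p) z ^+ (i * b) = \sum_(i < p) (z ^+ b) ^+ i - 1.
  rewrite -(big_mkord xpredT (fun i => (z ^+ b) ^+ i)) big_ltn // expr0 [1 + _]addrC addrK.
  by apply: eq_bigr => i _; rewrite mulnC exprM.
congr (_ - 1); rewrite (prim_order_dvd z_pr).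
have [->|zb] := eqVneq (z ^+ b) 1.
  by rewrite muln1 (eq_bigr (fun=> 1)) => [|i _]; rewrite ?sumr_const ?card_ord ?expr1n.
rewrite muln0; apply/eqP; have /eqP := subrX1 (z ^+ b) p.
by rewrite -exprM mulnC exprM (prim_expr_order z_pr) expr1n subrr eq_sym mulf_eq0 subr_eq0 (negbTE zb).
Qed.

Lemma prod_one_sub_zeta : \prod_(s < p.-1) (1 - z ^+ (r ^ s)) = p%:R.
Proof.
rewrite (big_exp_mod p_pr r_prim _ (F := fun i => 1 - z ^+ i)) => [|i]; last first.
  by rewrite prim_expr_mod.
have := factor_Xn_sub_1 z_pr; rewrite big_ltn // expr0 subrX1 => E.
have {}E := mulfI (monic_neq0 (monicXsubC (1 : algC))) E.
transitivity (\prod_(1 <= i < p) ('X - (z ^+ i)%:P)).[1].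
  by rewrite horner_prod; apply: eq_bigr => i _; rewrite !hornerE.
rewrite E horner_sum (eq_bigr (fun=> 1)) => [|i _]; last by rewrite hornerXn expr1n.
by rewrite sumr_const card_ord.
Qed.

Lemma iter_one_sub_zeta s : iter s sigma (1 - z) = 1 - z ^+ (r ^ s).
Proof. by rewrite rmorphB rmorph1 /= iter_zeta. Qed.

Let alphaE : alpha p r = \prod_(j < h) (1 - z ^+ (r ^ j)).
Proof.
rewrite /alpha (_ : (p - 3)./2.+1 = h) //.
have h0 : (0 < h)%N by rewrite -double_gt0 -p2 (prim_order_gt0 r_prim).
by move: h0 p2; rewrite /h; lia.
Qed.

Let z1 : 1 - z != 0.
Proof.
rewrite subr_eq0 eq_sym -[z]expr1 -(prim_order_dvd z_pr) dvdn1.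
by rewrite neq_ltn prime_gt1 ?orbT.
Qed.

(** [sigma] shifts the product by one place: the factor 1 - z leaves and 1 - z^(r^h) = 1 - z^-1 =
    -z^-1 (1 - z) enters. *)
Let sigma_alpha : sigma (alpha p r) = - z^-1 * alpha p r.
Proof.
apply: (mulfI z1); rewrite alphaE rmorph_prod.
rewrite (eq_bigr (fun j : 'I_h => 1 - z ^+ (r ^ j.+1))) => [|j _]; last first.
  by rewrite rmorphB rmorph1 rmorphXn /= sigma_zeta -exprM expnS.
transitivity (\prod_(j < h.+1) (1 - z ^+ (r ^ j))).
  by rewrite big_ord_recl expn0 expr1.
rewrite big_ord_recr /= z_half; move: (\prod__ _) => A.
by field; exact: z0.
Qed.

(** [lambda] is chosen for this: [sigma] multiplies z^lambda by z^(lambda (r-1)) = z, which cancels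
    the z^-1 of [sigma_alpha]. *)
Lemma sigma_sqrt_p : sigma a = - a.
Proof.
rewrite /a rmorphM sigma_alpha fmorphXz /= sigma_zeta exprnP exprz_exp.
have -> : z ^ (r%:Z * lambda) = z ^ lambda * z.
  have := lambda_r; move/eqP; rewrite eqz_mod_dvd => /dvdzP[q E].
  have -> : r%:Z * lambda = lambda + (p%:Z * q + 1) by rewrite mulrC [p%:Z * q]mulrC -E; ring.
  rewrite !expfzDr // expr1z -exprz_exp -exprnP (prim_expr_order z_pr).
  by rewrite exp1rz mul1r.
by move: (z ^ lambda) => b; field; exact: z0.
Qed.

Let iter_a s : iter s sigma a = (-1) ^+ s * a.
Proof.
elim: s => [|s IH]; first by rewrite mul1r.
by rewrite iterS IH rmorphM rmorphXn rmorphN1 sigma_sqrt_p exprSr mulrN mulrN1 mulNr.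
Qed.

(** The left side is a times its image under sigma^h. As sigma^h inverts z, the powers z^lambda
    cancel and the two half products form the full product of the 1 - z^(r^s). *)
Lemma sqr_sqrt_p : (-1) ^+ h * a ^+ 2 = p%:R.
Proof.
transitivity (a * iter h sigma a); first by rewrite iter_a; ring.
rewrite {1}/a /a rmorphM fmorphXz /= iter_zeta z_half.
have -> : z^-1 ^ lambda = (z ^ lambda)^-1 by rewrite exprz_inv invr_expz.
rewrite mulrACA divff ?mul1r ?expfz_neq0 //.
rewrite alphaE rmorph_prod -prod_one_sub_zeta p2 -addnn big_split_ord /=.
congr (_ * _); apply: eq_bigr => j _.
by rewrite rmorphB rmorph1 rmorphXn /= iter_zeta -exprM -expnD.
Qed.

Let z_Aint : z \in Aint := Aint_prim_root z_pr.

Lemma one_sub_zeta_dvd b : (1 - z %| 1 - z ^+ b)%A.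
Proof.
apply/dvdAP; exists (\sum_(i < b) z ^+ i).
  by rewrite rpred_sum // => i _; rewrite rpredX.
by rewrite -[LHS]opprB subrX1 -mulNr opprB mulrC.
Qed.

Lemma dvd_one_sub_zeta s : (1 - z ^+ (r ^ s) %| 1 - z)%A.
Proof.
have rs : (r ^ (s * p.-1) = 1 %[mod p])%N.
  apply/eqP; rewrite -(expn0 r) (eqn_mod_exp p_pr r_prim).
  by rewrite modnMl mod0n.
have [->|s0] := posnP s; first by rewrite expn0 expr1 dvdA_refl.
(* The second exponent inverts r^s modulo p, since r^(s(p-1)) is 1 modulo p. *)
have {1}-> : z = (z ^+ (r ^ s)) ^+ (r ^ (s * p.-1 - s)).
  rewrite -exprM -expnD subnKC; last first.
    by rewrite leq_pmulr // (prim_order_gt0 r_prim).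
  by rewrite -[LHS]expr1; apply/eqP; rewrite (eq_prim_root_expr z_pr) rs.
move: (z ^+ (r ^ s)) (rpredX (r ^ s) z_Aint) => y Ay.
apply/dvdAP; exists (\sum_(i < r ^ (s * p.-1 - s)) y ^+ i).
  by rewrite rpred_sum // => i _; rewrite rpredX.
by rewrite -[LHS]opprB subrX1 -mulNr opprB mulrC.
Qed.

Lemma p_dvd_one_sub_zeta : (p%:R%R %| (1 - z) ^+ p.-1)%A.
Proof.
rewrite -prod_one_sub_zeta -[X in (1 - z) ^+ X]card_ord -prodr_const.
by apply: dvdA_prod => i _; apply: dvd_one_sub_zeta.
Qed.

Variable l : nat.
Hypotheses (l_odd : odd l) (l_gt1 : (1 < l)%N) (p_l : (p = 1 %[mod l])%N).

Let n := (p.-1 %/ l)%N.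
Let x := xx p l r lambda sigma.

Let nl : (n * l)%N = p.-1.
Proof.
rewrite divnK //; have /eqP := p_l; rewrite eqn_mod_dvd // ?subn1 //.
Qed.

Let n_even : odd n = false.
Proof. by have := congr1 odd nl; rewrite oddM l_odd andbT p2 odd_double. Qed.

Let n_gt0 : (0 < n)%N.
Proof. by move: (prim_order_gt0 r_prim); rewrite -nl muln_gt0 => /andP[]. Qed.

Let zzE : zz p r lambda = a * (1 - z). Proof. by []. Qed.

Let F s := iter s sigma (zz p r lambda).

Lemma iter_zz s : iter s sigma (zz p r lambda) = (-1) ^+ s * a * (1 - z ^+ (r ^ s)).
Proof. by rewrite zzE rmorphM /= iter_a iter_one_sub_zeta. Qed.

Let F_period s : F (s + p.-1)%N = F s.
Proof.
rewrite /F !iter_zz -[(-1) ^+ (s + _)]signr_odd oddD p2 odd_double addbF signr_odd -p2.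
congr (_ * (1 - _)); apply/eqP; rewrite (eq_prim_root_expr z_pr).
by rewrite (eqn_mod_exp p_pr r_prim) modnDr.
Qed.

Lemma xxE : x = \sum_(j < n) F (j * l)%N.
Proof.
rewrite /x /xx subn1 -/n big_add1 /= big_mkord.
rewrite -(@big_ord_shift _ _ _ n (fun j => F (j * l)%N) 1%N) => [|i].
  by apply: eq_bigr => j _; rewrite addn1.
by rewrite mulnDl nl F_period.
Qed.

Let iter_F s t : iter s sigma (F t) = F (t + s)%N.
Proof. by rewrite /F -iterD addnC. Qed.

Let iter_x s : iter s sigma x = \sum_(j < n) F (j * l + s)%N.
Proof. by rewrite xxE rmorph_sum /=; apply: eq_bigr => j _; rewrite iter_F. Qed.

Lemma iter_xx_period : iter l sigma x = x.
Proof.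
rewrite iter_x xxE -(@big_ord_shift _ _ _ n (fun j => F (j * l)%N) 1%N) => [|i].
  by apply: eq_bigr => j _; rewrite addn1 mulSn addnC.
by rewrite mulnDl nl F_period.
Qed.

(** Expanding (1 - z^(r^q))(1 - z^(r^q r^v)) leaves four sums over q: p-1, 1, 1, and a last one
    equal to -1 unless r^v = -1 modulo p, that is v = h, when it is p-1. In that case a^2 (-1)^v =
    p. *)
Let trace_zz v : \sum_(q < p.-1) F q * F (q + v)%N =
  a ^+ 2 * (-1) ^+ v * p%:R + p%:R ^+ 2 * (v == h %[mod p.-1])%:R.
Proof.
have E q : F q * F (q + v)%N = a ^+ 2 * (-1) ^+ v *
    (1 - z ^+ (r ^ q * 1) - z ^+ (r ^ q * r ^ v) + z ^+ (r ^ q * (r ^ v).+1)).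
  rewrite /F !iter_zz muln1 mulnS exprD expnD [z ^+ (_ + _)]exprD.
  have : (-1) ^+ q * (-1) ^+ q = 1 :> algC by rewrite -expr2 sqrr_sign.
  move: ((-1) ^+ q) (z ^+ (r ^ q)) (z ^+ _) => A B C A2.
  set D := RHS; rewrite -[D]mul1r -[1 in RHS]A2 /D; ring.
under eq_bigr do rewrite E.
rewrite -mulr_sumr big_split /= !sumrB !sum_zeta_exp sumr_const card_ord.
rewrite (dvdn_exp_add1 p_pr r_prim p_odd) dvdn1.
have -> : (p %| r ^ v)%N = false.
  apply/negP; rewrite (prim_order_dvd z_pr) => /eqP E1.
  have /dvdAP[y _] := dvd_one_sub_zeta v.
  by rewrite E1 subrr mulr0 => /eqP; rewrite (negbTE z1).
rewrite (gtn_eqF (prime_gt1 p_pr)) !muln0 sub0r.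
have -> : (1 : algC) *+ p.-1 = p%:R - 1 by rewrite -subn1 natrB.
case: (boolP (v == h %[mod p.-1])%N) => [vh|_]; last by rewrite muln0 mulr0n; ring.
have -> : a ^+ 2 * (-1) ^+ v = p%:R.
  rewrite -sqr_sqrt_p mulrC; congr (_ * _); rewrite -[LHS]signr_odd -[RHS]signr_odd.
  move/eqP: vh => /(congr1 odd).
  by rewrite !odd_mod ?p2 ?odd_double // => ->.
by rewrite muln1 mulr1n; ring.
Qed.

(** Unfolding x as a trace gives [trace_zz] at all v = ul + t with u < n. The sign terms cancel
    because l is odd and n even; the other term needs ul + t = h = (n/2)l, so t = 0 and u = n/2. *)
Lemma xx_orthogonal t : (t < l)%N ->
  \sum_(s < l) iter s sigma x * iter (s + t) sigma x = p%:R ^+ 2 * (t == 0)%:R.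
Proof.
move=> tl.
transitivity (\sum_(u < n) \sum_(q < p.-1) F q * F (q + (u * l + t))%N).
  rewrite -nl; under [RHS]eq_bigr do rewrite (big_ord_mul _ n l (fun q => F q * F (q + _)%N)).
  rewrite [RHS]exchange_big /=; under [RHS]eq_bigr do rewrite exchange_big /=.
  rewrite [RHS]exchange_big /=; apply: eq_bigr => s _.
  rewrite !iter_x mulr_suml; apply: eq_bigr => j _.
  rewrite -mulr_sumr; congr (_ * _).
  rewrite -(@big_ord_shift _ _ _ n (fun u => F (u * l + (s + t))%N) j) => [|i].
    by apply: eq_bigr => u _; congr F; ring.
  by rewrite mulnDl nl addnAC F_period.
under eq_bigr do rewrite trace_zz.
rewrite big_split /= -mulr_suml -mulr_sumr -mulr_sumr.
have -> : \sum_(u < n) (-1) ^+ (u * l + t) = 0 :> algC.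
  under eq_bigr do rewrite exprD mulnC exprM -signr_odd l_odd expr1.
  rewrite -mulr_suml; have := subrX1 (-1 : algC) n.
  rewrite -[(-1) ^+ n]signr_odd n_even expr0 subrr => /esym/eqP.
  rewrite mulf_eq0 -opprD oppr_eq0 -(natrD _ 1 1) pnatr_eq0 => /eqP->.
  by rewrite mul0r.
rewrite mulr0 mul0r add0r; congr (_ * _).
have hE : h = (n./2 * l)%N.
  by apply: double_inj; rewrite -p2 -nl doubleMl even_halfK // n_even.
have n2 : (n./2 < n)%N by rewrite ltn_half_double -addnn -{1}[n]addn0 ltn_add2l.
rewrite (bigD1 (Ordinal n2)) //= big1 ?addr0 => [|u un].
  rewrite hE -{2}[(n./2 * l)%N]addn0 eqn_modDl mod0n modn_small //.
  by rewrite (leq_trans tl) // -nl leq_pmull.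
have ub : (u * l + t < p.-1)%N.
  rewrite -nl; have /leq_trans-> // : (u * l + t < u.+1 * l)%N by rewrite mulSn addnC ltn_add2r.
  by rewrite leq_mul2r ltn_ord orbT.
have hb : (n./2 * l < p.-1)%N by rewrite -nl ltn_mul2r n2 (ltnW l_gt1).
rewrite hE !modn_small //.
case: eqP => // /(congr1 (fun i => i %/ l)%N).
by rewrite divnMDl ?(ltnW l_gt1) // mulnK ?(ltnW l_gt1) // divn_small // addn0 => E; case/eqP: un; apply: val_inj.
Qed.

Let poly_in_zV : poly_in Num.int z z^-1.
Proof.
have -> : z^-1 = z ^+ p.-1.
  by apply: (mulfI z0); rewrite divff // -exprS (prednK p0) (prim_expr_order z_pr).
exact: poly_inXn (poly_inX _ _).
Qed.

Let poly_in_a : poly_in Num.int z a.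
Proof.
apply: poly_inM.
  case: (lambda) => i; first exact: poly_inXn (poly_inX _ _).
  by rewrite NegzE -exprnN -exprVn; apply: poly_inXn.
rewrite alphaE; apply: poly_in_prod => i _.
by apply: poly_inB; [apply: poly_in1 | apply: poly_inXn (poly_inX _ _)].
Qed.

Lemma poly_in_iter (S : subringClosed algC) s y :
  {in S, sigma =1 id} -> poly_in S z y -> poly_in S z (iter s sigma y).
Proof.
move=> Sid; elim: s => // s IH /IH [q Sq E]; rewrite iterS E.
have -> : sigma q.[z] = q.[z ^+ r].
  rewrite -horner_map /= sigma_zeta; congr _.[_]; apply/polyP => i.
  by rewrite coef_map /= Sid // (polyOverP Sq).
apply: poly_in_trans (poly_inXn r (poly_inX _ _)) _.
by exists q.
Qed.

Let int_id : {in Num.int, sigma =1 id}.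
Proof. by move=> _ /intrP[c ->]; rewrite rmorph_int. Qed.

Lemma xx_poly_in : poly_in Num.int z x.
Proof.
rewrite xxE; apply: poly_in_sum => j _; apply: poly_in_iter; first exact: int_id.
rewrite zzE; apply: poly_inM => //.
by apply: poly_inB; [apply: poly_in1 | apply: poly_inX].
Qed.

(* a^2 = +-p contributes p^(p-1); the cofactor x/a is divisible by 1 - zeta, so its
   2(p-1)-th power contributes p^2. *)
Lemma dvd_xx_exp : (p%:R ^+ p.+1 %| x ^+ (2 * p.-1))%A.
Proof.
pose y := \sum_(j < n) (-1) ^+ (j * l) * (1 - z ^+ (r ^ (j * l))).
have -> : x = a * y.
  rewrite xxE /y mulr_sumr; apply: eq_bigr => j _.
  by rewrite /F iter_zz; ring.
have zy : (1 - z %| y)%A.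
  apply: rpred_sum => j _; apply: dvdA_mull; first by rewrite rpredX // rpredN.
  exact: one_sub_zeta_dvd.
have py : (p%:R %| y ^+ p.-1)%A by apply: dvdA_trans p_dvd_one_sub_zeta (dvdA_exp _ zy).
rewrite exprMn exprM.
have -> : a ^+ 2 = (-1) ^+ h * p%:R.
  by rewrite -sqr_sqrt_p mulrA -expr2 sqrr_sign mul1r.
rewrite (_ : p.+1 = p.-1 + 2)%N; last by rewrite addn2 (prednK p0).
rewrite exprMn exprD; apply: dvdA_mul.
  by rewrite dvdA_mull ?dvdA_refl // !rpredX // rpredN.
by rewrite mulnC exprM; apply: dvdA_exp.
Qed.

(** A fixed element is its own average over p-1 powers of [sigma], and each monomial in z has
    rational sum by [sum_zeta_exp]. *)
Lemma Crat_zeta_fixed y : poly_in Crat z y -> sigma y = y -> y \in Crat.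
Proof.
move=> [q Qq yE] sy.
have iy s : iter s sigma y = y by elim: s => // s IH; rewrite iterS IH.
have p1 : p.-1%:R != 0 :> algC by rewrite pnatr_eq0 -lt0n (prim_order_gt0 r_prim).
suff Qp : p.-1%:R * y \in Crat by rewrite -[y](mulKf p1) rpredM // rpredV rpred_nat.
have -> : p.-1%:R * y = \sum_(s < p.-1) iter s sigma y.
  under eq_bigr do rewrite iy.
  by rewrite sumr_const card_ord mulr_natl.
have -> : \sum_(s < p.-1) iter s sigma y =
    \sum_(i < size q) q`_i * \sum_(s < p.-1) z ^+ (r ^ s * i).
  under [RHS]eq_bigr do rewrite mulr_sumr.
  rewrite exchange_big; apply: eq_bigr => s _.
  rewrite yE horner_coef rmorph_sum; apply: eq_bigr => i _.
  rewrite rmorphM rmorphXn [X in X * _](aut_Crat _ (polyOverP Qq i)) /= iter_zeta.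
  by rewrite -exprM.
apply: rpred_sum => i _; rewrite sum_zeta_exp.
by rewrite rpredM ?(polyOverP Qq) // rpredB // rpred_nat.
Qed.

Hypotheses (x_neq0 : x != 0) (xsigma : poly_in Num.int z (sigma x / x)).

Let p_neq0 : p%:R != 0 :> algC.
Proof. by rewrite pnatr_eq0 -lt0n. Qed.

Let x_Aint : x \in Aint.
Proof. exact: poly_in_Aint xx_poly_in. Qed.

Lemma xx_dvd_iter s : (x %| iter s sigma x)%A.
Proof.
elim: s => [|s IH]; first exact: dvdA_refl.
have -> : iter s.+1 sigma x = iter s sigma (sigma x / x) * iter s sigma x.
  by rewrite -[RHS]rmorphM divfK // iterSr.
apply: dvdA_mull IH; rewrite Aint_aut.
exact: poly_in_Aint xsigma.
Qed.

Let iter_mul_l s : iter (s * l) sigma x = x.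
Proof. by elim: s => // s IH; rewrite mulSnr iterD iter_xx_period IH. Qed.

(** sigma^(sl) fixes x, so this is sigma^s applied to x | sigma^(sl-s)(x). *)
Lemma iter_dvd_xx s : (iter s sigma x %| x)%A.
Proof.
have := dvdA_aut (iter s sigma) (xx_dvd_iter (s * l - s)).
by rewrite /= -iterD subnKC ?iter_mul_l // leq_pmulr // ltnW.
Qed.

Lemma xx_norm_Crat : \prod_(s < l) iter s sigma x \in Crat.
Proof.
apply: Crat_zeta_fixed.
  apply: poly_in_prod => s _; apply: poly_in_iter.
    by move=> y Qy; apply: aut_Crat.
  exact: poly_in_int_Crat xx_poly_in.
rewrite rmorph_prod -(@big_ord_shift _ _ _ l (fun s => iter s sigma x) 1%N).
  by apply: eq_bigr => s _; rewrite addn1.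
by move=> s; rewrite iterD iter_xx_period.
Qed.

Lemma xx_norm : exists2 f, `|\prod_(s < l) iter s sigma x| = p%:R ^+ f &
  [/\ (x ^+ l %| p%:R ^+ f)%A, (p%:R ^+ f %| x ^+ l)%A & (l < 2 * f)%N].
Proof.
set P := \prod_(s < l) _.
have xP : (x ^+ l %| P)%A.
  by rewrite -[X in x ^+ X]card_ord -prodr_const; apply: dvdA_prod => s _; apply: xx_dvd_iter.
have Px : (P %| x ^+ l)%A.
  by rewrite -[X in x ^+ X]card_ord -prodr_const; apply: dvdA_prod => s _; apply: iter_dvd_xx.
(* Orthogonality at t = 0 writes p^2 as the sum of the squared conjugates, all divisible by x^2.
   This forces the norm, an integer, to be a power of p up to sign. *)
have x2p2 : (x ^+ 2 %| p%:R ^+ 2)%A.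
  have := xx_orthogonal (ltnW l_gt1); rewrite mulr1 => <-.
  apply: rpred_sum => s _; rewrite addn0 -expr2; apply: dvdA_exp; exact: xx_dvd_iter.
have P2 : (P ^+ 2 %| p%:R ^+ (2 * l))%A.
  apply: dvdA_trans (dvdA_exp 2 Px) _.
  by rewrite -exprM [(l * 2)%N]mulnC !exprM; apply: dvdA_exp.
have [m mE] : exists m : nat, `|P| = m%:R.
  apply/natrP; rewrite natr_norm_int //; apply: Cint_rat_Aint xx_norm_Crat _.
  by rewrite rpred_prod // => s _; rewrite Aint_aut.
have [b PE] : exists b : bool, P = (-1) ^+ b * m%:R.
  exists (P < 0); rewrite -mE; apply: realEsign.
  by apply: Creal_Crat xx_norm_Crat.
have mP : (m%:R %| P)%A /\ (P %| m%:R)%A.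
  have Ab : (-1) ^+ b \in Aint by rewrite rpredX // rpredN.
  split; first by rewrite PE dvdA_mull ?dvdA_refl.
  rewrite (_ : m%:R = (-1) ^+ b * P); first by rewrite dvdA_mull ?dvdA_refl.
  by rewrite PE mulrA -expr2 sqrr_sign mul1r.
have [f fl mf] : exists2 f, (f <= 2 * l)%N & m = (p ^ f)%N.
  apply/(dvdn_pfactor _ _ p_pr); apply: (@dvdn_trans (m ^ 2)); first by rewrite dvdn_exp.
  rewrite -dvdA_nat !natrX; apply: dvdA_trans P2.
  by apply: dvdA_exp; case: mP.
exists f; first by rewrite mE mf natrX.
rewrite -natrX -mf; case: mP => mP Pm; split.
- exact: dvdA_trans xP Pm.
- exact: dvdA_trans mP Px.
(* Both powers are compared with x^(2(p-1)l). If 2f were at most l, the exponents would give p + 1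
   <= p - 1. *)
have : (p ^ (p.+1 * l) %| p ^ (2 * p.-1 * f))%N.
  have := dvdA_exp (2 * p.-1) (dvdA_trans xP Pm); have := dvdA_exp l dvd_xx_exp.
  rewrite mf natrX -!exprM [(l * _)%N]mulnC [(f * _)%N]mulnC => d1 d2.
  by rewrite -dvdA_nat !natrX; apply: dvdA_trans d1 d2.
rewrite dvdn_Pexp2l ?prime_gt1 //.
move=> le1; rewrite ltnNge; apply/negP => f2l; have := leq_trans le1.
move=> /(_ (p.-1 * l)%N); rewrite leq_pmul2r ?(ltnW l_gt1) // -mulnA mulnCA leq_mul2l f2l orbT.
by move=> /(_ isT); rewrite ltnNge leq_pred.
Qed.

(** The witness is the norm of 1 - zeta from Q(zeta) to K; its l conjugates are associated and
    multiply to p. *)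
Lemma uniformizer : exists2 y, poly_in Num.int z y /\ iter l sigma y = y &
  [/\ (p%:R %| y ^+ l)%A, (y ^+ l %| p%:R)%A & ~~ (y %| 1)%A].
Proof.
pose y := \prod_(j < n) iter (j * l) sigma (1 - z).
have iy s : iter s sigma y = \prod_(j < n) iter (j * l + s) sigma (1 - z).
  by rewrite rmorph_prod; apply: eq_bigr => j _; rewrite addnC [RHS]iterD.
have Ny : \prod_(s < l) iter s sigma y = p%:R.
  under eq_bigr do rewrite iy.
  rewrite exchange_big /= -(big_ord_mul _ n l (fun q => iter q sigma (1 - z))) nl.
  by rewrite -prod_one_sub_zeta; apply: eq_bigr => q _; rewrite iter_one_sub_zeta.
have py : (p%:R %| y ^+ l)%A.
  rewrite -Ny -[X in y ^+ X]card_ord -prodr_const; apply: dvdA_prod => s _.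
  rewrite iy; apply: dvdA_prod => j _; rewrite !iter_one_sub_zeta.
  by apply: dvdA_trans (dvd_one_sub_zeta _) (one_sub_zeta_dvd _).
exists y.
  split.
    apply: poly_in_prod => j _; apply: poly_in_iter; first exact: int_id.
    by apply: poly_inB; [apply: poly_in1 | apply: poly_inX].
  rewrite iy /y -(@big_ord_shift _ _ _ n (fun j => iter (j * l) sigma (1 - z)) 1%N) => [|j].
    by apply: eq_bigr => j _; rewrite addn1 mulSn addnC.
  rewrite mulnDl nl !iter_one_sub_zeta; congr (1 - _); apply/eqP.
  by rewrite (eq_prim_root_expr z_pr) (eqn_mod_exp p_pr r_prim) modnDr.
split=> //.
  rewrite -Ny -[X in y ^+ X]card_ord -prodr_const; apply: dvdA_prod => s _.
  rewrite iy; apply: dvdA_prod => j _; rewrite !iter_one_sub_zeta.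
  by apply: dvdA_trans (dvd_one_sub_zeta _) (one_sub_zeta_dvd _).
apply/negP => /(dvdA_exp l); rewrite expr1n => /(dvdA_trans py).
by rewrite -[1]/(1%:R) dvdA_nat dvdn1 gtn_eqF ?prime_gt1.
Qed.

End GaussPeriod.

(** * The compositum *)

Lemma chinese_aut m n a b : coprime m n -> coprime a m -> coprime b n ->
  {nu : {rmorphism algC -> algC} |
    (forall z, z ^+ m = 1 -> nu z = z ^+ a) /\ (forall w, w ^+ n = 1 -> nu w = w ^+ b)}.
Proof.
move=> mn am bn; pose c := chinese m n a b.
have cm : (c = a %[mod m])%N := chinese_modl mn a b.
have cn : (c = b %[mod n])%N := chinese_modr mn a b.
have co : coprime c (m * n).
  by rewrite coprimeMr -coprime_modl cm coprime_modl am -coprime_modl cn coprime_modl.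
have [nu nuE] := Qn_aut_exists co; exists nu; split=> u u1.
  by rewrite nuE ?exprM ?u1 ?expr1n // -(expr_mod _ u1) cm expr_mod.
by rewrite nuE 1?mulnC ?exprM ?u1 ?expr1n // -(expr_mod _ u1) cn expr_mod.
Qed.

Section Compositum.

Variables (l p r : nat) (lambda : int) (m : nat) (sigma : {rmorphism algC -> algC}).
Hypotheses (l_gt1 : (1 < l)%N) (l_odd : odd l) (p_pr : prime p) (p_l : (p = 1 %[mod l])%N).
Hypothesis r_prim : (p.-1).-primitive_root (r%:R : 'F_p).
Hypothesis lambda_r : (lambda * (r%:Z - 1) = 1 %[mod p%:Z])%Z.
Hypothesis sigma_zeta : sigma (zeta p) = zeta p ^+ r.
Hypothesis m_ge3 : (3 <= m)%N.

Let e := (m - 2)%N.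
Let k := (2 ^ (m - 2))%N.
Let z := zeta p.
Let w := omega m.
Let th := theta m.
Let x := xx p l r lambda sigma.
Let x_ s := iter s sigma x.

Lemma odd_of_mod1 : odd p.
Proof.
have [p2|//] := even_prime p_pr.
by move: p_l; rewrite p2 => /eqP; rewrite eqn_mod_dvd // subn1 dvdn1 gtn_eqF.
Qed.

Let p_odd := odd_of_mod1.
Let p0 : (0 < p)%N := prime_gt0 p_pr.
Let z_pr : p.-primitive_root z := prim_zeta p_pr p_odd.

Let e_gt0 : (0 < e)%N. Proof. by rewrite subn_gt0. Qed.

Let k4 : (2 ^ m = 4 * k)%N.
Proof. by rewrite /k -(expnD 2 2) subnKC // ltnW. Qed.

Let w_pr : (4 * k).-primitive_root w.
Proof. by rewrite -k4; apply: prim_omega; apply: ltn_trans m_ge3. Qed.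

Let pk : coprime p (4 * k).
Proof. by rewrite -k4 coprime_sym coprime_pexpl ?(ltn_trans _ m_ge3) // coprime2n. Qed.

Lemma coprime_exp_primitive s : coprime (r ^ s) p.
Proof.
rewrite coprime_sym prime_coprime //; apply/negP => ps.
have := prim_root_eq0 r_prim; rewrite -[p.-1 == 0]negbK -lt0n (prim_order_gt0 r_prim).
have : (r%:R : 'F_p) ^+ s == 0 by rewrite -natrX -val_eqE /= val_Fp_nat //; apply: ps.
by rewrite expf_eq0 => /andP[_ ->].
Qed.

(** [sigma] may act arbitrarily on [omega m]. Here [G s j] acts as sigma^s on Q(zeta) and by w ->
    w^(2j+1) on Q(omega), so [G s 0] fixes L; coprimality of p and 2^m makes the two choices
    independent. *)
Lemma galois_exists : exists G : nat -> nat -> {rmorphism algC -> algC},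
  forall s j, G s j z = z ^+ (r ^ s) /\ G s j w = w ^+ (2 * j).+1.
Proof.
have wk c : coprime (2 * c).+1 (4 * k).
  by rewrite -k4 coprime_pexpr ?(ltn_trans _ m_ge3) // coprimen2 /= oddM.
pose g s j := chinese_aut pk (coprime_exp_primitive s) (wk j).
exists (fun s j => sval (g s j)) => s j; case: (svalP (g s j)) => gz gw.
by rewrite gz ?(prim_expr_order z_pr) // gw ?(prim_expr_order w_pr).
Qed.

Variable G : nat -> nat -> {rmorphism algC -> algC}.
Hypothesis Gzw : forall s j, G s j z = z ^+ (r ^ s) /\ G s j w = w ^+ (2 * j).+1.

Let Gz s j : G s j z = z ^+ (r ^ s) := proj1 (Gzw s j).
Let Gw s j : G s j w = w ^+ (2 * j).+1 := proj2 (Gzw s j).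

Let thE : th = w + w^-1. Proof. by []. Qed.

Let Gth s j : G s j th = w ^+ (2 * j).+1 + w ^- (2 * j).+1.
Proof. by rewrite thE rmorphD fmorphV Gw. Qed.

Let K_poly y : inK p l sigma y -> poly_in Crat z y.
Proof. by case=> /(poly_in_unity_Crat_span y z_pr). Qed.

Let L_poly y : inL m y -> poly_in Crat th y.
Proof. exact: Crat_span_poly_in. Qed.

Let GK s j y : poly_in Crat z y -> G s j y = iter s sigma y.
Proof.
by move=> zy; rewrite -[RHS]/((iter s sigma : {rmorphism algC -> algC}) y); apply: eq_poly_in zy;
  rewrite Gz /= (iter_zeta sigma_zeta).
Qed.

Let GL s t j y : poly_in Crat th y -> G s j y = G t j y.
Proof. by apply: eq_poly_in; rewrite !Gth. Qed.

Let GL0 s y : poly_in Crat th y -> G s 0 y = y.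
Proof.
have -> : y = (idfun : {rmorphism algC -> algC}) y by [].
by move=> thy /=; apply: (eq_poly_in (mu := idfun)) thy; rewrite Gth.
Qed.

Let KL_ind (C : algC -> Prop) :
  C 0 -> (forall y y', C y -> C y' -> C (y + y')) ->
  (forall a b, inK p l sigma a -> inL m b -> C (a * b)) ->
  forall y, inKL p l sigma m y -> C y.
Proof.
move=> C0 CD CM y [s [sKL ->]]; rewrite big_seq.
by elim/big_ind: _ => // ab /sKL[]; apply: CM.
Qed.

Let KL0 : inKL p l sigma m 0.
Proof. by exists [::]; rewrite big_nil. Qed.

Let KLM a b : inK p l sigma a -> inL m b -> inKL p l sigma m (a * b).
Proof.
move=> aK bL; exists [:: (a, b)]; rewrite big_seq1; split=> // ab.
by rewrite inE => /eqP->.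
Qed.

Let KLD y y' : inKL p l sigma m y -> inKL p l sigma m y' -> inKL p l sigma m (y + y').
Proof.
move=> [s [sKL ->]] [s' [sKL' ->]]; exists (s ++ s'); rewrite big_cat; split=> // ab.
by rewrite mem_cat => /orP[/sKL|/sKL'].
Qed.

Let K_of_poly y : poly_in Crat z y -> iter l sigma y = y -> inK p l sigma y.
Proof. by move=> zy yl; split=> //; apply/(poly_in_unity_Crat_span y z_pr). Qed.

Let KM a b : inK p l sigma a -> inK p l sigma b -> inK p l sigma (a * b).
Proof.
move=> aK bK; apply: K_of_poly; first exact: poly_inM (K_poly aK) (K_poly bK).
by case: aK bK => _ aE [_ bE]; rewrite rmorphM /= aE bE.
Qed.

Let KL_KM a y : inK p l sigma a -> inKL p l sigma m y -> inKL p l sigma m (a * y).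
Proof.
move=> aK; elim/KL_ind: y / => [|y y' IH IH'|b c bK cL].
- by rewrite mulr0.
- by rewrite mulrDr; apply: KLD.
- by rewrite mulrA; apply: KLM => //; apply: KM.
Qed.

Let L1 : inL m 1.
Proof.
by rewrite /inL -[1](hornerC 1 th); apply: Crat_span_horner; rewrite ?polyOverC ?rpred1 // size_polyC oner_eq0 expn_gt0.
Qed.

Let KL_K a : inK p l sigma a -> inKL p l sigma m a.
Proof. by move=> aK; rewrite -[a]mulr1; apply: KLM. Qed.

Let K_Crat c : c \in Crat -> inK p l sigma c.
Proof.
move=> Qc; apply: K_of_poly; first exact: poly_inC.
by rewrite -[LHS]/((iter l sigma : {rmorphism algC -> algC}) c) aut_Crat.
Qed.

Let x_poly s : poly_in Num.int z (x_ s).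
Proof.
apply: (poly_in_iter (r := r) sigma_zeta) => [_ /intrP[c ->]|]; first by rewrite rmorph_int.
by apply: xx_poly_in.
Qed.

Let p_neq0 : p%:R != 0 :> algC.
Proof. by rewrite pnatr_eq0 -lt0n. Qed.

Let x_l : iter l sigma x = x.
Proof. by apply: (iter_xx_period p_pr p_odd r_prim lambda_r sigma_zeta p_l). Qed.

Let xK s : inK p l sigma (x_ s).
Proof.
apply: K_of_poly; first exact: poly_in_int_Crat (x_poly s).
by rewrite -iterD addnC iterD x_l.
Qed.

Let w_Aint : w \in Aint := Aint_prim_root w_pr.

Let wV_Aint : w^-1 \in Aint.
Proof.
have k40 : (0 < 4 * k)%N := prim_order_gt0 w_pr.
by apply/(Aint_unity_root k40)/unity_rootP; rewrite exprVn (prim_expr_order w_pr) invr1.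
Qed.

Let th_Aint : th \in Aint. Proof. by rewrite thE rpredD. Qed.

(** * The trace from KL to L and its integrality *)

Let relTr v := \sum_(s < l) G s 0 v.

Let relTr_L v : inKL p l sigma m v -> inL m (relTr v).
Proof.
rewrite /relTr; elim/KL_ind: v / => [|v v' IH IH'|a b aK bL].
- by rewrite big1 => [|s _]; rewrite ?rmorph0 // /inL rpred0.
- by under eq_bigr do rewrite rmorphD; rewrite big_split; apply: rpredD.
have az := K_poly aK; have := L_poly bL => bth.
under eq_bigr do rewrite rmorphM (GL0 _ bth) (GK _ _ az).
rewrite -mulr_suml; apply: Crat_spanM bL.
apply: (Crat_zeta_fixed p_pr p_odd r_prim sigma_zeta).
  apply: poly_in_sum => s _; apply: (poly_in_iter sigma_zeta) az => c Qc.
  exact: aut_Crat.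
rewrite rmorph_sum -(@big_ord_shift _ _ _ l (fun s => iter s sigma a) 1%N).
  by apply: eq_bigr => s _; rewrite addn1.
by move=> s; rewrite iterD; case: aK => _ ->.
Qed.

Let rho_w j : G 0 j w = w ^+ (2 * j).+1 := Gw 0 j.

Let OL_poly y : inOL m y -> poly_in Num.int th y.
Proof.
move=> [yL Ay]; exact: (Aint_poly_in_real_2power e_gt0 w_pr rho_w Ay (L_poly yL)).
Qed.

Let p_le : (l <= p)%N.
Proof.
rewrite leqNgt; apply/negP => pl; move: p_l; rewrite !modn_small // => p1.
by move: (prime_gt1 p_pr); rewrite p1.
Qed.

(* t = p Tr(v) lies in Z[theta] and p divides t^p, hence also the conjugate nu(t)
   by the Frobenius congruence nu(t) = t^p mod p. *)
Lemma relTr_Aint v : inKL p l sigma m v -> (p%:R %| (p%:R * v) ^+ l)%A ->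
  inOL m (relTr v).
Proof.
move=> vKL pv; split; first exact: relTr_L.
have pvl s : (p%:R %| G s 0 (p%:R * v) ^+ l)%A.
  by have := dvdA_aut (G s 0) pv; rewrite rmorph_nat rmorphXn.
have AV s : G s 0 (p%:R * v) \in Aint.
  by apply: Aint_dvdA_exp (pvl s); rewrite ?(ltnW l_gt1) // Aint_Cnat // rpred_nat.
pose t := p%:R * relTr v.
have tE : t = \sum_(s < l) G s 0 (p%:R * v).
  by rewrite /t mulr_sumr; apply: eq_bigr => s _; rewrite rmorphM rmorph_nat.
have At : t \in Aint by rewrite tE rpred_sum.
have ptp : (p%:R %| t ^+ p)%A.
  rewrite -eqAmod0 tE.
  apply: eqAmod_trans (eqAmod_expr_sum p_pr _) _ => //.
  rewrite eqAmod0 rpred_sum // => s _.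
  (* Divisibility by p is known for the l-th power and passes to the p-th because l <= p. *)
  by rewrite -[X in _ ^+ X](subnKC p_le) exprD dvdA_mulr // rpredX.
have tth : poly_in Num.int th t.
  apply: OL_poly; split=> //; apply: Crat_spanM; first exact: rpred_nat.
  exact: relTr_L.
(* Index [p./2] is the one for which [G 0] raises w to the power p. *)
have p2 : (2 * p./2).+1 = p by rewrite mul2n -add1n -[RHS]odd_double_half p_odd.
pose nu := G 0 p./2.
have wfrob : w \in frob p nu by apply/frobP; rewrite rho_w p2.
have tfrob : t \in frob p nu.
  have sr := frob_subring p_pr nu p_odd; apply: poly_in_int_closed tth => //.
  have [_ fB _] := sr.
  have wVfrob : w^-1 \in frob p nu by apply/frobP; rewrite fmorphV rho_w p2 exprVn.
  (* [subring_closed] offers only differences, so the sum w + w^-1 is rewritten with them. *)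
  have -> : th = w - (w - w - w^-1) by rewrite subrr sub0r opprK.
  by rewrite !fB.
have pt : (p%:R %| t)%A.
  move/frobP: tfrob => [_ tnu].
  have : (p%:R %| nu t)%A by rewrite -eqAmod0 -(eqAmod_transl _ tnu) eqAmod0.
  rewrite !dvdA_div //; have -> : p%:R = nu p%:R by rewrite rmorph_nat.
  by rewrite -fmorph_div Aint_aut rmorph_nat.
by move: pt; rewrite dvdA_div // /t mulrC mulKf.
Qed.

(** * The equality of calI and x O_KL *)

Hypotheses (x_neq0 : x != 0) (xsigma : poly_in Num.int z (sigma x / x)).

Let x_dvd s : (x %| x_ s)%A.
Proof. exact: (xx_dvd_iter p_pr p_odd x_neq0 xsigma). Qed.

Let dvd_x s : (x_ s %| x)%A.
Proof. by apply: (iter_dvd_xx p_pr p_odd r_prim lambda_r sigma_zeta l_gt1 p_l x_neq0 xsigma). Qed.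

Let x_orth t : (t < l)%N -> \sum_(s < l) x_ s * x_ (s + t)%N = p%:R ^+ 2 * (t == 0)%:R.
Proof. by apply: (xx_orthogonal p_pr p_odd r_prim lambda_r sigma_zeta l_odd l_gt1 p_l). Qed.

Let xr_K s : inK p l sigma (x_ s / x).
Proof.
apply: K_of_poly; last first.
  by rewrite fmorph_div /= -iterD addnC iterD !x_l.
elim: s => [|s IH]; first by rewrite divff //; apply: poly_in1.
have -> : x_ s.+1 / x = iter s sigma (sigma x / x) * (x_ s / x).
  by rewrite fmorph_div /= -iterSr mulrA divfK // fmorph_eq0.
apply: poly_inM IH; apply: (poly_in_iter sigma_zeta) (poly_in_int_Crat xsigma).
by move=> c Qc; apply: aut_Crat.
Qed.

Let KD a b : inK p l sigma a -> inK p l sigma b -> inK p l sigma (a + b).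
Proof.
move=> aK bK; apply: K_of_poly; first exact: poly_inD (K_poly aK) (K_poly bK).
by case: aK bK => _ aE [_ bE]; rewrite rmorphD /= aE bE.
Qed.

Let I_div a : inI p l r lambda sigma a -> inK p l sigma (a / x) /\ (x %| a)%A.
Proof.
move: a; apply: Cint_span_ind => [|a b [aK xa] [bK xb]|c _ /mapP[s _ ->]].
- by rewrite mul0r rpred0; split=> //; apply: K_Crat; apply: rpred0.
- by rewrite mulrDl rpredD //; split=> //; apply: KD.
rewrite -mulrA; split; last by apply: dvdA_mull (x_dvd s); apply: Aint_int.
by apply: KM (xr_K s); apply: K_Crat; apply: rpred_int.
Qed.

(** Each conjugate of x is x times an integer of K, by integrality of sigma(x)/x. *)
Lemma calI_sub y : incalI p l r lambda sigma m y ->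
  exists w, inOKL p l sigma m w /\ y = x * w.
Proof.
move=> [s [sI ->]]; exists ((\sum_(ab <- s) ab.1 * ab.2) / x).
split; last by rewrite mulrC divfK.
split.
  rewrite mulr_suml big_seq; elim/big_ind: _ => // ab /sI[aI [bL _]].
  by rewrite mulrAC; apply: KLM => //; case: (I_div aI).
rewrite -dvdA_div // big_seq rpred_sum // => ab /sI[aI [_ bA]].
by apply: dvdA_mulr => //; case: (I_div aI).
Qed.

Let G00 y : inKL p l sigma m y -> G 0 0 y = y.
Proof.
elim/KL_ind: y / => [|y y' IH IH'|a b aK bL]; first by rewrite rmorph0.
- by rewrite rmorphD IH IH'.
by rewrite rmorphM (GL0 _ (L_poly bL)) (GK _ _ (K_poly aK)).
Qed.

(* The matrix (x_(s+i) / p) is symmetric, so the orthogonality of its columns is also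
   that of its rows, which expands xv over the x_i with coefficients T i. *)
Lemma mem_calI v : inKL p l sigma m v -> (p%:R %| (x ^+ 2 / p%:R * v) ^+ l)%A ->
  incalI p l r lambda sigma m (x * v).
Proof.
move=> vKL pv.
have V_K i : inK p l sigma (p%:R ^- 2 * x * x_ i).
  apply: KM (xK i); apply: KM (xK 0); apply: K_Crat.
  by rewrite rpredV rpredX // rpred_nat.
pose T i := relTr (p%:R ^- 2 * x * x_ i * v).
have T_OL i : inOL m (T i).
  apply: relTr_Aint; first exact: KL_KM.
  have /dvdAP[c Ac xE] := x_dvd i.
  have -> : p%:R * (p%:R ^- 2 * x * x_ i * v) = c * (x ^+ 2 / p%:R * v).
    by rewrite xE; field.
  by rewrite exprMn dvdA_mull // rpredX.
exists [seq (x_ i, T i) | i <- iota 0 l]; split.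
  move=> _ /mapP[i il ->]; split=> //=; apply: mem_Cint_span.
  by apply/mapP; exists i.
rewrite big_map (_ : iota 0 l = index_iota 0 l); last by rewrite /index_iota subn0.
rewrite big_mkord /T /relTr /=.
under eq_bigr do rewrite mulr_sumr.
rewrite exchange_big /= (bigD1 (Ordinal (ltnW l_gt1))) //=.
have GE s i : G s 0 (p%:R ^- 2 * x * x_ i * v) = p%:R ^- 2 * G s 0 (x * v) * x_ (i + s)%N.
  rewrite !rmorphM fmorphV rmorphXn rmorph_nat (GK _ _ (poly_in_int_Crat (x_poly i))).
  by rewrite -iterD [(s + i)%N]addnC; ring.
rewrite [X in _ + X]big1 ?addr0 => [|s s0].
  under eq_bigr do rewrite GE mulrCA.
  rewrite -mulr_sumr x_orth ?(ltnW l_gt1) // mulr1 G00; last exact: KL_KM (xK 0) vKL.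
  by field.
under eq_bigr do rewrite GE mulrCA.
rewrite -mulr_sumr x_orth // (_ : (nat_of_ord s == 0) = false) ?mulr0n ?mulr0 //.
by apply: negbTE; apply: contra s0 => /eqP s0; apply/eqP/val_inj.
Qed.

Let pA : p%:R \in Aint. Proof. by rewrite rpred_nat. Qed.

(** If the exponent f of [xx_norm] had 2f >= l + 2, then [mem_calI] would accept a v that behaves
    like the inverse of the uniformizer, while [calI_sub] makes v integral. *)
Lemma xx_norm_exponent :
  `|\prod_(s < l) x_ s| = p%:R ^+ (l.+1)./2 /\ (p%:R ^+ l.+1 %| x ^+ (2 * l))%A.
Proof.
have [f Nf [xpf pfx lf]] :
    exists2 f, `|\prod_(s < l) iter s sigma x| = p%:R ^+ f &
    [/\ (x ^+ l %| p%:R ^+ f)%A, (p%:R ^+ f %| x ^+ l)%A & (l < 2 * f)%N].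
  exact: (xx_norm p_pr p_odd r_prim lambda_r sigma_zeta l_odd l_gt1 p_l x_neq0 xsigma).
have p2f : (p%:R ^+ (2 * f) %| x ^+ (2 * l))%A.
  by rewrite mulnC [(2 * f)%N]mulnC !exprM; apply: dvdA_exp.
suff fl : (2 * f = l.+1)%N.
  by rewrite -fl; split; rewrite // mul2n doubleK.
apply/eqP; rewrite eqn_leq lf andbT leqNgt; apply/negP => fl.
have [y [Zy ly] [py yp yN1]] : exists2 y, poly_in Num.int z y /\ iter l sigma y = y &
    [/\ (p%:R %| y ^+ l)%A, (y ^+ l %| p%:R)%A & ~~ (y %| 1)%A].
  exact: (uniformizer p_pr p_odd r_prim sigma_zeta p_l).
have yK i : inK p l sigma (y ^+ i).
  apply: K_of_poly; last by rewrite rmorphXn /= ly.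
  exact: poly_inXn (poly_in_int_Crat Zy).
have y0 : y != 0.
  by apply/eqP => y0; move: yp; rewrite y0 expr0n gtn_eqF ?(ltnW l_gt1) //= unfold_in eqxx (negbTE p_neq0).
(* v has the valuation of y^-1 *)
pose v := y ^+ l.-1 / p%:R.
have vKL : inKL p l sigma m v.
  by apply: KL_K; rewrite /v mulrC; apply: KM => //; apply: K_Crat; rewrite rpredV rpred_nat.
(* After clearing p^(2l), x^(2l) supplies p^(l+2) and y^(l(l-1)) supplies p^(l-1): exponent 2l + 1,
   one more than was cleared. *)
have pv : (p%:R %| (x ^+ 2 / p%:R * v) ^+ l)%A.
  rewrite -(dvdA_mul2l (z := p%:R ^+ (2 * l))) ?expf_neq0 //.
  have -> : p%:R ^+ (2 * l) * (x ^+ 2 / p%:R * v) ^+ l = x ^+ (2 * l) * (y ^+ l) ^+ l.-1.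
    rewrite !exprM [(y ^+ l) ^+ _]exprAC -!exprMn /v; congr (_ ^+ _).
    by field.
  have d : (p%:R ^+ l.+2 * p%:R ^+ l.-1 %| x ^+ (2 * l) * (y ^+ l) ^+ l.-1)%A.
    apply: dvdA_mul; last exact: dvdA_exp.
    by apply: dvdA_trans p2f; apply: dvdA_exp2l.
  rewrite -exprSr (_ : (2 * l).+1 = l.+2 + l.-1)%N; first by rewrite [p%:R ^+ _]exprD.
  by rewrite addSnnS (prednK (ltnW l_gt1)) mul2n -addnn.
have [u [[_ Au] /(mulfI x_neq0) vE]] := calI_sub (mem_calI vKL pv).
move: yN1; apply/negP/negPn; rewrite dvdA_div // mul1r.
have /dvdAP[c Ac pE] := yp.
have -> : y^-1 = c * u.
  have c0 : c != 0 by apply: contraNneq p_neq0 => c0; rewrite pE c0 mul0r.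
  have yl : y ^+ l = y * y ^+ l.-1 by rewrite -exprS (prednK (ltnW l_gt1)).
  rewrite -vE /v pE yl; move: (y ^+ l.-1) (expf_neq0 l.-1 y0) => Y Y0.
  by field; rewrite Y0 y0 c0.
by rewrite rpredM.
Qed.

(** For integral v the hypothesis of [mem_calI] follows from p^(l+1) | x^(2l), the second half of
    [xx_norm_exponent]. *)
Lemma calI_eq y : incalI p l r lambda sigma m y <->
  exists v, inOKL p l sigma m v /\ y = x * v.
Proof.
split; first exact: calI_sub.
move=> [v [[vKL Av] ->]]; apply: mem_calI => //.
rewrite -(dvdA_mul2l (z := p%:R ^+ l)) ?expf_neq0 // -exprSr.
rewrite -exprMn (_ : p%:R * _ = x ^+ 2 * v); last by field.
rewrite exprMn -exprM; apply: dvdA_mulr; first by rewrite rpredX.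
by case: xx_norm_exponent.
Qed.

(** A single generator for a cyclotomic field containing KL; z and w are powers of it by the Chinese
    remainder theorem. *)
Let xi := z * w.

Let xi_z : poly_in Crat xi z.
Proof.
have -> : z = xi ^+ chinese p (4 * k) 1 0.
  rewrite exprMn -(prim_expr_mod z_pr) -(prim_expr_mod w_pr).
  by rewrite chinese_modl // chinese_modr // mod0n mulr1 prim_expr_mod.
exact: poly_inXn (poly_inX _ _).
Qed.

Let xi_w : poly_in Crat xi w.
Proof.
have -> : w = xi ^+ chinese p (4 * k) 0 1.
  rewrite exprMn -(prim_expr_mod z_pr) -(prim_expr_mod w_pr).
  by rewrite chinese_modl // chinese_modr // mod0n mul1r prim_expr_mod.
exact: poly_inXn (poly_inX _ _).
Qed.

Let KL_poly y : inKL p l sigma m y -> poly_in Crat xi y.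
Proof.
have k40 : (0 < 4 * k)%N := prim_order_gt0 w_pr.
have w_th : poly_in Crat w th.
  apply: poly_inD; first exact: poly_inX.
  have -> : w^-1 = w ^+ (4 * k).-1.
    apply: (mulfI (_ : w != 0)); first by rewrite (prim_root_eq0 w_pr) -lt0n.
    by rewrite divff ?(prim_root_eq0 w_pr) -?lt0n // -exprS prednK // (prim_expr_order w_pr).
  exact: poly_inXn (poly_inX _ _).
elim/KL_ind: y / => [|y y' IH IH'|a b aK bL]; first exact: poly_in0.
  exact: poly_inD.
apply: poly_inM; first exact: poly_in_trans xi_z (K_poly aK).
exact: poly_in_trans xi_w (poly_in_trans w_th (L_poly bL)).
Qed.

Let sum_omega i : \sum_(j < 2 * k) w ^+ ((2 * j).+1 * i) \in Crat.
Proof.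
pose v := w ^+ i.
have -> : \sum_(j < 2 * k) w ^+ ((2 * j).+1 * i) = v * \sum_(j < 2 * k) (v ^+ 2) ^+ j.
  by rewrite mulr_sumr; apply: eq_bigr => j _; rewrite mulnC exprM exprS exprM.
have [v2|v2] := eqVneq (v ^+ 2) 1.
  have Qv : v \in Crat.
    by move/eqP: v2; rewrite sqrf_eq1 => /orP[]/eqP->; rewrite ?rpredN rpred1.
  by rewrite rpredM // rpred_sum // => j _; rewrite v2 expr1n rpred1.
have /eqP := subrX1 (v ^+ 2) (2 * k).
rewrite -exprM mulnA -exprM mulnC exprM (prim_expr_order w_pr) expr1n subrr eq_sym.
by rewrite mulf_eq0 subr_eq0 (negbTE v2) => /eqP->; rewrite mulr0 rpred0.
Qed.

(** Averaging again, now over j < 2k instead of k: the polynomial in [xi] involves w itself, so all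
    odd exponents modulo 4k are needed. *)
Let Crat_fixed y : poly_in Crat xi y -> (forall s j, G s j y = y) -> y \in Crat.
Proof.
move=> [q Qq yE] Gy.
have c0 : (p.-1 * (2 * k))%:R != 0 :> algC.
  rewrite pnatr_eq0 -lt0n !muln_gt0 (prim_order_gt0 r_prim) /=.
  by have := prim_order_gt0 w_pr; rewrite muln_gt0.
suff Qc : (p.-1 * (2 * k))%:R * y \in Crat.
  by rewrite -[y](mulKf c0) rpredM // rpredV rpred_nat.
have -> : (p.-1 * (2 * k))%:R * y = \sum_(s < p.-1) \sum_(j < 2 * k) G s j y.
  under eq_bigr do (under eq_bigr do rewrite Gy; rewrite sumr_const card_ord).
  by rewrite sumr_const card_ord -mulrnA mulnC mulr_natl.
have -> : \sum_(s < p.-1) \sum_(j < 2 * k) G s j y = \sum_(i < size q) q`_i *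
    ((\sum_(s < p.-1) z ^+ (r ^ s * i)) * \sum_(j < 2 * k) w ^+ ((2 * j).+1 * i)).
  under [RHS]eq_bigr do rewrite mulr_suml mulr_sumr.
  rewrite [RHS]exchange_big /=.
  apply: eq_bigr => s _.
  under [RHS]eq_bigr do rewrite mulr_sumr mulr_sumr.
  rewrite exchange_big; apply: eq_bigr => j _.
  rewrite yE horner_coef rmorph_sum; apply: eq_bigr => i _.
  rewrite rmorphM rmorphXn (aut_Crat _ (polyOverP Qq i)) rmorphM Gz Gw exprMn.
  by rewrite -!exprM.
apply: rpred_sum => i _; rewrite (sum_zeta_exp p_pr p_odd r_prim).
by rewrite rpredM ?(polyOverP Qq) // rpredM // rpredB // rpred_nat.
Qed.

(** * The embeddings of KL and the norm of x *)

Variables (N : nat) (E : 'I_N -> {rmorphism algC -> algC}).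
Hypothesis hE : embeddings_of (inKL p l sigma m) E.

Let L_th : inL m th.
Proof.
apply: mem_Crat_span; apply/mapP; exists 1%N; rewrite ?expr1 // mem_iota /=.
by rewrite -(expn0 2) ltn_exp2l // (ltn_trans _ m_ge3).
Qed.

Let KL_th : inKL p l sigma m th.
Proof. by rewrite -[th]mul1r; apply: KLM L_th; apply: K_Crat; apply: rpred1. Qed.

Let KL_x : inKL p l sigma m x := KL_K (xK 0).

Let w0 : w != 0.
Proof. by rewrite (prim_root_eq0 w_pr) -lt0n (prim_order_gt0 w_pr). Qed.

Let Gth_inj s t i j : (i < k)%N -> (j < k)%N -> G s i th = G t j th -> i = j.
Proof.
move=> ik jk; rewrite !Gth => /eqP.
have ui : w ^+ (2 * i).+1 != 0 by rewrite expf_neq0.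
have uj : w ^+ (2 * j).+1 != 0 by rewrite expf_neq0.
(* u + u^-1 = v + v^-1 forces u = v or uv = 1; the latter needs 4k to divide 2i + 2j + 2, which is
   positive and below 4k. *)
rewrite -subr_eq0 (_ : _ - _ = (w ^+ (2 * i).+1 - w ^+ (2 * j).+1) *
    (w ^+ ((2 * i).+1 + (2 * j).+1) - 1) / (w ^+ (2 * i).+1 * w ^+ (2 * j).+1)); last first.
  rewrite exprD; move: (w ^+ _) (w ^+ (2 * j).+1) ui uj => a b a0 b0.
  by field; rewrite a0 b0.
rewrite !mulf_eq0 invr_eq0 mulf_eq0 (negbTE ui) (negbTE uj) !orbF !subr_eq0.
rewrite -(prim_order_dvd w_pr) (eq_prim_root_expr w_pr).
case/orP => [|/dvdn_leq]; first by rewrite !modn_small; [move/eqP | | ]; clear -ik jk; lia.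
by move=> /(_ isT); clear -ik jk; lia.
Qed.

(** Two equal conjugates would have scalar product p^2 instead of 0 in [x_orth]. *)
Let x_inj s t : (s < l)%N -> (t < l)%N -> x_ s = x_ t -> s = t.
Proof.
wlog st : s t / (s <= t)%N => [IH sl tl E1|sl tl].
  by have [/IH->//|/ltnW/IH->//] := leqP s t.
rewrite /x_ -{1}(subnKC st) iterD => /(fmorph_inj (iter s sigma)) E1.
apply/eqP; rewrite eqn_leq st /= -subn_eq0; apply/negPn/negP => ts.
have tsl : (t - s < l)%N by apply: leq_ltn_trans (leq_subr _ _) tl.
have := x_orth tsl; have := x_orth (ltnW l_gt1).
under eq_bigr do rewrite addn0.
rewrite mulr1 => E2; under eq_bigr do rewrite /x_ iterD -E1.
rewrite E2 (_ : (t - s == 0)%N = false) ?mulr0 => [/eqP|]; last exact: negbTE.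
by rewrite expf_eq0 (negbTE p_neq0).
Qed.

Let E_G i : exists2 sj : 'I_l * 'I_k, True & forall y, inKL p l sigma m y -> E i y = G sj.1 sj.2 y.
Proof.
have [b Eb] : {b : 'I_p | E i z = z ^+ b}.
  by apply: (prim_rootP z_pr); rewrite -rmorphXn (prim_expr_order z_pr) rmorph1.
have [c Ec] : {c : 'I_(4 * k) | E i w = w ^+ c}.
  by apply: (prim_rootP w_pr); rewrite -rmorphXn (prim_expr_order w_pr) rmorph1.
have pb : ~~ (p %| b)%N.
  rewrite (prim_order_dvd z_pr) -Eb fmorph_eq1 -[z]expr1 -(prim_order_dvd z_pr) dvdn1.
  by rewrite gtn_eqF ?prime_gt1.
have [s0 bs] := exp_mod_surj p_pr r_prim pb.
have l0 : (0 < l)%N := ltnW l_gt1.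
have EK y : inK p l sigma y -> E i y = iter (s0 %% l) sigma y.
  move=> yK; have -> : E i y = iter s0 sigma y.
    rewrite -[RHS]/((iter s0 sigma : {rmorphism algC -> algC}) y).
    apply: eq_poly_in (K_poly yK); rewrite /= (iter_zeta sigma_zeta) Eb.
    by apply/eqP; rewrite (eq_prim_root_expr z_pr).
  case: yK => _ yl; rewrite {1}(divn_eq s0 l) addnC iterD; congr (iter _ _ _).
  by elim: (s0 %/ l)%N => // q IH; rewrite mulSnr iterD yl.
(* An even c would send w^(2k) = -1 to 1. *)
have c_odd : odd c.
  apply/negPn/negP => /negbTE c_even.
  have := congr1 (E i) (expr_prim_half w_pr); rewrite rmorphXn rmorphN1 /= Ec -exprM.
  rewrite -[X in (X * _)%N]odd_double_half c_even add0n -muln2 -mulnA mulnA mulnA.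
  rewrite -[(_ * 2 * 2)%N]mulnA -mulnA mulnC exprM (prim_expr_order w_pr) expr1n.
  by move/eqP; rewrite -addr_eq0 -(natrD _ 1 1) pnatr_eq0.
have [j jk Eth] : exists2 j, (j < k)%N & E i th = w ^+ (2 * j).+1 + w ^- (2 * j).+1.
  have cE : (c : nat) = (2 * c./2).+1.
    by have := odd_double_half c; rewrite c_odd -mul2n add1n => ->.
  (* The exponents c and 4k - c agree on theta, and one of these odd numbers is below 2k. *)
  have EthE : E i th = w ^+ c + w ^- c by rewrite thE rmorphD fmorphV Ec.
  have := ltn_ord c; case: (ltnP c./2 k) => ck c4; first by exists c./2; rewrite // -cE.
  exists (2 * k - c./2.+1)%N; first by clear -ck c4 cE; lia.
  rewrite EthE addrC.
  have -> : (2 * (2 * k - c./2.+1)).+1 = (4 * k - c)%N by clear -ck c4 cE; lia.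
  have wc : w ^+ (4 * k - c) = w ^- c.
    apply: (mulIf (expf_neq0 c w0)); rewrite -exprD subnK ?(ltnW c4) //.
    by rewrite (prim_expr_order w_pr) mulVf ?expf_neq0.
  by rewrite wc invrK.
have sl : (s0 %% l < l)%N by rewrite ltn_pmod.
exists (Ordinal sl, Ordinal jk) => // y.
elim/KL_ind: y / => [|y y' IH IH'|a a' aK aL]; first by rewrite !rmorph0.
  by rewrite !rmorphD IH IH'.
rewrite !rmorphM EK // (GK _ _ (K_poly aK)); congr (_ * _).
by apply: eq_poly_in (L_poly aL); rewrite Eth Gth.
Qed.

(** [N] is arbitrary in the theorem; this matching yields N = kl. The elements theta and x separate
    the [G s j], and the separation property of [E] gives surjectivity. *)
Lemma embeddings_bij : exists2 h : 'I_l * 'I_k -> 'I_N, bijective h &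
  forall sj y, inKL p l sigma m y -> E (h sj) y = G sj.1 sj.2 y.
Proof.
have [hE1 hE2] := hE.
have /fin_all_exists[h hP] : forall sj : 'I_l * 'I_k, exists i : 'I_N,
    forall y, inKL p l sigma m y -> G sj.1 sj.2 y = E i y.
  by move=> sj; apply: hE2.
have h_inj : injective h.
  move=> [s j] [t i] hst; have Gst y : inKL p l sigma m y -> G s j y = G t i y.
    by move=> yKL; have := hP (s, j) y yKL; have := hP (t, i) y yKL; rewrite hst /= => <-.
  have /val_inj-> : j = i :> nat by apply: Gth_inj (Gst th KL_th); apply: ltn_ord.
  have xp := poly_in_int_Crat (x_poly 0).
  have := Gst x KL_x; rewrite (GK s j xp) (GK t i xp) => E1.
  by have /val_inj-> : s = t :> nat by apply: x_inj E1; apply: ltn_ord.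
exists h => [|sj y yKL]; last by rewrite hP.
have /fin_all_exists[g gP] : forall i, exists sj, h sj = i.
  move=> i; have [sj _ EG] := E_G i; exists sj; apply/eqP/negPn/negP => /hE1[y [yKL]].
  by rewrite EG // -hP // eqxx.
by exists g; first apply: inj_can_sym.
Qed.

Lemma card_embeddings : N = (k * l)%N.
Proof.
have [h h_bij _] := embeddings_bij.
by rewrite -[LHS]card_ord -(bij_eq_card h_bij) card_prod !card_ord mulnC.
Qed.

Lemma big_embeddings (T : Type) (idx : T) (op : Monoid.com_law idx) (F : algC -> T) y :
  inKL p l sigma m y ->
  \big[op/idx]_(i < N) F (E i y) = \big[op/idx]_(s < l) \big[op/idx]_(j < k) F (G s j y).
Proof.
move=> yKL; have [h h_bij hP] := embeddings_bij.
rewrite (reindex h) /=; last exact: onW_bij.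
by rewrite pair_big; apply: eq_bigr => sj _; rewrite hP.
Qed.

(** x lies in K, so its norm is the k-th power of its norm from K: exponent k(l+1)/2. *)
Lemma normKL_xx : `|normKL E x| = p%:R ^+ ((k * l + k)./2).
Proof.
have xp := poly_in_int_Crat (x_poly 0).
rewrite /normKL (big_embeddings _ id KL_x).
under eq_bigr do (under eq_bigr do rewrite (GK _ _ xp); rewrite prodr_const card_ord).
rewrite prodrXl normrX; case: xx_norm_exponent => -> _.
rewrite -exprM mulnC; congr (_ ^+ _).
have E1 : l.+1 = ((l.+1)./2).*2 by rewrite even_halfK //= l_odd.
by rewrite addnC -mulnS {2}E1 -doubleMr doubleK mulnC.
Qed.

(** * The orthonormal basis of calI *)

Let f j := dirichlet w j.
Let eta : algC := 2 - th.
(** The normalizing constant: p^2 is the square length of x over K and 2k that of each f_j for the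
    weight [eta]. *)
Let c : algC := p%:R ^- 2 * (2 * k)%:R^-1.
Let beta : algC := (p%:R ^+ 2)^-1 * (k%:R^-1 - theta m / (2 * k)%:R).

Let k_gt0 : (0 < k)%N. Proof. by rewrite expn_gt0. Qed.

Let k_neq0 : k%:R != 0 :> algC. Proof. by rewrite pnatr_eq0 -lt0n. Qed.

Let betaE : beta = c * eta.
Proof. by rewrite /beta /c /eta -/th natrM; field; rewrite k_neq0 p_neq0. Qed.

Let cK : inK p l sigma c.
Proof. by apply: K_Crat; rewrite rpredM // rpredV ?rpredX // rpred_nat. Qed.

Let f_poly j : poly_in Num.int th (f j).
Proof. exact: (poly_in_dirichlet w_pr). Qed.

Let f_OL j : (j < k)%N -> inOL m (f j).
Proof.
move=> jk; split; last exact: poly_in_Aint th_Aint (f_poly j).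
have [q [Qq sq fE]] := dirichlet_poly_in w_pr Crat j.
rewrite /inL /f fE; apply: Crat_span_horner => //.
by rewrite (leq_trans sq) // (leq_trans jk) // leq_exp2l // leq_subr.
Qed.

Let OL_span (S : subringClosed algC) y : poly_in S th y -> dirichlet_span (m - 2) w S y.
Proof. exact: (poly_in_dirichlet_span e_gt0 w_pr). Qed.

Let L_of_poly y : poly_in Crat th y -> inL m y.
Proof.
move=> /OL_span[d Qd ->]; rewrite /inL rpred_sum // => j _.
by apply: Crat_spanM => //; case: (f_OL (ltn_ord j)).
Qed.

Let eta_poly : poly_in Crat th eta.
Proof. by apply: poly_inB; [apply: poly_in_nat | apply: poly_inX]. Qed.

Let KL_beta : inKL p l sigma m beta.
Proof. by rewrite betaE; apply: KLM => //; apply: L_of_poly. Qed.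

Let G_beta s j : G s j beta = c * G 0 j eta.
Proof.
have [] := cK => _ _; rewrite betaE rmorphM (GL s 0 j eta_poly); congr (_ * _).
by rewrite aut_Crat // rpredM // rpredV ?rpredX // rpred_nat.
Qed.

Let c_gt0 : 0 < c.
Proof. by rewrite mulr_gt0 ?invr_gt0 ?exprn_gt0 ?ltr0n ?muln_gt0. Qed.

Let E_beta_gt0 i : 0 < E i beta.
Proof.
have [sj _ ->] := E_G i; last exact: KL_beta.
by rewrite G_beta mulr_gt0 // (rho_eta_gt0 w_pr rho_w).
Qed.

Let bas a := x_ (a %/ k) * f (a %% k).

Let KL_bas2 a b : inKL p l sigma m (beta * (bas a * bas b)).
Proof.
rewrite betaE /bas (_ : _ * _ = (c * x_ (a %/ k) * x_ (b %/ k)) * (eta * (f (a %% k) * f (b %% k)))); last by ring.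
apply: KLM; first by apply: KM (xK _); apply: KM.
apply: L_of_poly; apply: poly_inM => //.
by apply: poly_inM; apply: poly_in_int_Crat.
Qed.

Let x_orth2 a b : (a < l)%N -> (b < l)%N ->
  \sum_(s < l) x_ (a + s) * x_ (b + s) = p%:R ^+ 2 * (a == b)%:R.
Proof.
wlog ab : a b / (a <= b)%N => [IH al bl|al bl].
  have [/IH->//|/ltnW/IH E1] := leqP a b.
  by rewrite eq_sym -E1 //; apply: eq_bigr => s _; rewrite mulrC.
transitivity (\sum_(s < l) x_ (s + a) * x_ (s + a + (b - a))).
  by apply: eq_bigr => s _; rewrite -addnA subnKC // ![(_ + s)%N]addnC.
rewrite (@big_ord_shift _ _ _ l (fun s => x_ s * x_ (s + (b - a)))) => [|s].
  rewrite x_orth; last by rewrite (leq_ltn_trans (leq_subr _ _)).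
  by rewrite [in RHS]eqn_leq ab /= -subn_eq0.
by rewrite addnAC /x_ ![iter (_ + l) _ _]iterD x_l.
Qed.

(** The square roots of the conjugates of beta pair up, leaving the trace of beta u v, which factors
    into a sum over K and a sum over L. *)
Lemma basis_orthonormal a b : (a < k * l)%N -> (b < k * l)%N ->
  \sum_(i < N) phi_coord E beta (bas a) i * phi_coord E beta (bas b) i = (a == b)%:R.
Proof.
move=> aN bN.
transitivity (\sum_(i < N) E i (beta * (bas a * bas b))).
  apply: eq_bigr => i _; by rewrite rmorphM [E i (_ * _)]rmorphM /phi_coord mulrACA -expr2 sqrtCK.
rewrite (big_embeddings _ id (KL_bas2 a b)) /=.
have GE s j : G s j (beta * (bas a * bas b)) = (c * (x_ (a %/ k + s) * x_ (b %/ k + s))) *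
    G 0 j (eta * (f (a %% k) * f (b %% k))).
  have fQ i : G s j (f i) = G 0 j (f i).
    exact: GL (poly_in_int_Crat (f_poly i)).
  have xQ i : G s j (x_ i) = x_ (i + s)%N.
    by rewrite (GK _ _ (poly_in_int_Crat (x_poly i))) -iterD addnC.
  rewrite rmorphM G_beta rmorphM /bas.
  rewrite (rmorphM (G s j) (x_ (a %/ k))) (rmorphM (G s j) (x_ (b %/ k))).
  by rewrite (rmorphM (G 0 j) eta) (rmorphM (G 0 j) (f (a %% k))) !fQ !xQ; ring.
under eq_bigr do (under eq_bigr do rewrite GE; rewrite -mulr_sumr).
have ak : (a %% k < k)%N by rewrite ltn_pmod.
have bk : (b %% k < k)%N by rewrite ltn_pmod.
have al : (a %/ k < l)%N by rewrite ltn_divLR // mulnC.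
have bl : (b %/ k < l)%N by rewrite ltn_divLR // mulnC.
rewrite -mulr_suml -mulr_sumr x_orth2 // (dirichlet_orthonormal e_gt0 w_pr rho_w) //.
have -> : (a == b)%:R = (a %/ k == b %/ k)%N%:R * (a %% k == b %% k)%N%:R :> algC.
  rewrite -natrM mulnb; congr (_ %:R); congr nat_of_bool.
  apply/eqP/andP => [->|[/eqP E1 /eqP E2]]; first by rewrite !eqxx.
  by rewrite (divn_eq a k) (divn_eq b k) E1 E2.
by rewrite /c natrM -/k; field; rewrite k_neq0 p_neq0.
Qed.

Lemma basis_calI a : (a < k * l)%N -> incalI p l r lambda sigma m (bas a).
Proof.
move=> aN; exists [:: (x_ (a %/ k), f (a %% k))]; rewrite big_seq1; split=> // ab.
rewrite inE => /eqP-> /=; split; last by apply: f_OL; rewrite ltn_pmod.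
apply: mem_Cint_span; apply/mapP; exists (a %/ k)%N => //.
by rewrite mem_iota /= ltn_divLR // mulnC.
Qed.

Lemma calI_basis_span y : incalI p l r lambda sigma m y ->
  y \in Cint_span (mkseq bas (k * l)).
Proof.
move=> [s [sI ->]]; rewrite big_seq rpred_sum // => ab /sI[aI bO].
move: ab.1 aI; apply: (@Cint_span_ind (fun a => a * ab.2 \in _)) => [|a1 a2 H1 H2|q _ /mapP[i il ->]].
- by rewrite mul0r rpred0.
- by rewrite mulrDl rpredD.
rewrite -mulrA; apply: Cint_spanM; first exact: intr_int.
have [d Zd ->] := OL_span (OL_poly bO); rewrite mulr_sumr rpred_sum // => j _.
rewrite mulrCA; apply: Cint_spanM; first exact: Zd.
apply: mem_Cint_span; apply/mapP; exists (i * k + j)%N.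
  move: il; rewrite !mem_iota /= => il.
  have /leq_trans : (i * k + j < i.+1 * k)%N by rewrite mulSnr ltn_add2l.
  by apply; rewrite mulnC leq_mul2l il orbT.
have jk : (j < k)%N := ltn_ord j.
by rewrite /bas divnMDl // divn_small // addn0 modnMDl modn_small.
Qed.

(** * The minimum product distance *)

Let KL_normE y : inKL p l sigma m y ->
  normKL E y = \prod_(s < l) \prod_(j < k) G s j y.
Proof. by move=> yKL; apply: (big_embeddings _ id yKL). Qed.

Let norm_beta : \prod_(i < N) E i beta = c ^+ (k * l) * 2 ^+ l.
Proof.
rewrite (big_embeddings _ id KL_beta) /=.
under eq_bigr do under eq_bigr do rewrite G_beta.
under eq_bigr do rewrite big_split /= prodr_const card_ord (prod_rho_eta e_gt0 w_pr rho_w).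
by rewrite prodr_const card_ord exprMn -exprM.
Qed.

Let D := \prod_(i < N) sqrtC (E i beta).

Let D_ge0 : 0 <= D.
Proof. by apply: prodr_ge0 => i _; rewrite sqrtC_ge0 ltW. Qed.

Let prod_distE y : prod_dist E beta y = D * `|normKL E y|.
Proof.
rewrite /prod_dist /normKL normr_prod -big_split; apply: eq_bigr => i _.
by rewrite /phi_coord normrM ger0_norm // sqrtC_ge0 ltW.
Qed.

(** Composing with [g] permutes the embeddings, by completeness and separation of [E]. *)
Let normKL_aut (g : {rmorphism algC -> algC}) y :
  inKL p l sigma m y -> g (normKL E y) = normKL E y.
Proof.
move=> yKL; have [hE1 hE2] := hE.
have /fin_all_exists[h hP] : forall i, exists j, forall y, inKL p l sigma m y -> g (E i y) = E j y.
  by move=> i; apply: (hE2 (g \o E i)).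
have h_inj : injective h.
  move=> i j hij; apply/eqP/negPn/negP => /hE1[v [vKL]].
  by rewrite -(inj_eq (fmorph_inj g)) !hP // hij eqxx.
rewrite /normKL rmorph_prod [RHS](reindex_inj h_inj).
by apply: eq_bigr => i _; rewrite hP.
Qed.

Let normKL_Crat y : inKL p l sigma m y -> normKL E y \in Crat.
Proof.
move=> yKL; apply: Crat_fixed => [|s t]; last exact: normKL_aut.
rewrite KL_normE //; apply: poly_in_prod => s _; apply: poly_in_prod => j _.
apply: poly_in_aut_closed (KL_poly yKL).
by rewrite /xi rmorphM Gz Gw; apply: poly_inM; apply: poly_inXn.
Qed.

Let normKL_ge1 y : inOKL p l sigma m y -> y != 0 -> 1 <= `|normKL E y|.
Proof.
move=> [yKL Ay] y0; apply: norm_intr_ge1.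
  apply: Cint_rat_Aint (normKL_Crat yKL) _.
  by rewrite rpred_prod // => i _; rewrite Aint_aut.
by apply/prodf_neq0 => i _; rewrite fmorph_eq0.
Qed.

Let d : algC := sqrtC (p%:R ^ (k%:Z - (k * l)%:Z) * 2%:R ^ (l%:Z - (k * l * (m - 1))%:Z)).

(** Compared after squaring: the norm of beta is (p^-2/(2k))^(kl) 2^l with 2k = 2^(m-1), and the
    norm of x squared is p^(kl+k) in absolute value. *)
Let dE : d = prod_dist E beta x.
Proof.
have expB (u : algC) (i j : nat) : u != 0 -> u ^ (i%:Z - j%:Z) = u ^+ i / u ^+ j.
  by move=> u0; rewrite expfzDr // exprnN.
have two0 : 2 != 0 :> algC by rewrite pnatr_eq0.
rewrite prod_distE normKL_xx /d !expB //.
set R := (X in sqrtC X).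
have R_ge0 : 0 <= R by rewrite !mulr_ge0 ?invr_ge0 ?exprn_ge0 ?ler0n.
apply/eqP; rewrite -(@eqrXn2 _ 2) ?sqrtC_ge0 // ?mulr_ge0 ?exprn_ge0 ?ler0n //.
rewrite sqrtCK exprMn /D -prodrXl.
under eq_bigr do rewrite sqrtCK.
rewrite norm_beta -exprM muln2 even_halfK; last first.
  by rewrite oddD oddM l_odd andbT addbb.
have k2 : (2 * k)%:R = 2 ^+ (m - 1) :> algC.
  by rewrite -natrX /k -expnS -subSn // ltnW.
have -> : c ^+ (k * l) = ((p%:R ^+ (k * l)) ^+ 2 * 2 ^+ (k * l * (m - 1)))^-1.
  rewrite /c k2 -invfM exprVn exprMn; congr (_ * _)^-1; first by rewrite exprAC.
  by rewrite -exprM mulnC.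
rewrite exprD; have two_n0 i : (2 : algC) ^+ i != 0 by rewrite expf_neq0.
have p_n0 i : (p%:R : algC) ^+ i != 0 by rewrite expf_neq0.
rewrite /R; move: (p%:R ^+ (k * l)) (2 ^+ (k * l * (m - 1))) (p_n0 (k * l)%N) (two_n0 (k * l * (m - 1))%N).
by move=> P Q P0 Q0; apply/eqP; field; rewrite P0 Q0.
Qed.

Lemma compositum_lattice :
  [/\ (forall y, incalI p l r lambda sigma m y <-> exists v, inOKL p l sigma m v /\ y = x * v),
   exists b : seq algC, size b = N /\ (forall y, y \in b -> incalI p l r lambda sigma m y) /\
     (forall y, incalI p l r lambda sigma m y -> y \in Cint_span b) /\
     (forall i j : nat, (i < N)%N -> (j < N)%N ->
        \sum_(q < N) phi_coord E beta (nth 0 b i) q * phi_coord E beta (nth 0 b j) q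
          = (i == j)%:R),
   (forall y, incalI p l r lambda sigma m y -> y != 0 -> d <= prod_dist E beta y) /\
     (forall eps : algC, 0 < eps ->
        exists y, [/\ incalI p l r lambda sigma m y, y != 0 & prod_dist E beta y < d + eps]) &
   `|normKL E x| = p%:R ^+ ((k * l + k)./2)].
Proof.
split; [exact: calI_eq | | | exact: normKL_xx].
  have NE := card_embeddings; exists (mkseq bas (k * l)); rewrite size_mkseq; split=> //.
  split; first by move=> y /mapP[a]; rewrite mem_iota => /andP[_ aN] ->; apply: basis_calI.
  split; first exact: calI_basis_span.
  move=> a b; rewrite [X in (_ < X)%N -> _]NE [X in _ -> (_ < X)%N -> _]NE => aN bN.
  by rewrite !nth_mkseq //; apply: basis_orthonormal.
(* For y = xv the product distance is d times |N(v)|, and N(v) is a nonzero rational integer; so d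
   is a minimum, attained at x. *)
split=> [y /calI_eq[v [vO ->]] xv0 | eps eps0].
  have v0 : v != 0 by apply: contraNneq xv0 => ->; rewrite mulr0.
  have -> : prod_dist E beta (x * v) = d * `|normKL E v|.
    rewrite dE !prod_distE -mulrA -normrM /normKL -big_split /=.
    by under [in RHS]eq_bigr do rewrite -rmorphM.
  by rewrite ler_peMr ?normKL_ge1 // dE prod_distE mulr_ge0.
exists x; split=> //; last by rewrite -dE ltrDl.
apply/calI_eq; exists 1; rewrite mulr1; split=> //; split; last exact: Aint1.
by apply: KL_K; apply: K_Crat; apply: rpred1.
Qed.

End Compositum.

Unset Implicit Arguments.
Set Strict Implicit.

Theorem theorem10 (l p r : nat) (lambda : int) (m : nat)
  (sigma : {rmorphism algC -> algC}) (N : nat)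
  (E : 'I_N -> {rmorphism algC -> algC}) :
  (1 < l)%N -> odd l -> prime p -> p = 1 %[mod l] ->
  (p.-1).-primitive_root (r%:R : 'F_p) ->
  (lambda * (r%:Z - 1) = 1 %[mod p%:Z])%Z ->
  sigma (zeta p) = zeta p ^+ r ->
  (3 <= m)%N ->
  embeddings_of (inKL p l sigma m) E ->
  let k := (2 ^ (m - 2))%N in
  let n := (k * l)%N in
  let x := xx p l r lambda sigma in
  let beta := (p%:R ^+ 2)^-1 * (k%:R^-1 - theta m / (2 * k)%:R) : algC in
  x != 0 -> inZzeta p (sigma x / x) ->
  (* calI = x O_KL *)
  (forall y, incalI p l r lambda sigma m y <-> exists w, inOKL p l sigma m w /\ y = x * w) /\
  (* phi_beta(calI) is a rotated Z^n *)
  (exists b : seq algC,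
     size b = N /\ (forall y, y \in b -> incalI p l r lambda sigma m y) /\
     (forall y, incalI p l r lambda sigma m y -> y \in Cint_span b) /\
     (forall a c : nat, (a < N)%N -> (c < N)%N ->
        \sum_(i < N) phi_coord E beta (nth 0 b a) i * phi_coord E beta (nth 0 b c) i
          = (a == c)%:R)) /\
  (* d_{p,min}(phi_beta(calI)) = p^{(k-n)/2} 2^{(l-n(m-1))/2}, as an infimum *)
  (let d := sqrtC (p%:R ^ (k%:Z - n%:Z) * 2%:R ^ (l%:Z - (n * (m - 1))%:Z)) : algC in
     (forall y, incalI p l r lambda sigma m y -> y != 0 -> d <= prod_dist E beta y) /\
     (forall eps : algC, 0 < eps ->
        exists y, [/\ incalI p l r lambda sigma m y, y != 0 & prod_dist E beta y < d + eps])) /\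
  (* |N_KL(x)| = p^{(n+k)/2} *)
  `|normKL E x| = p%:R ^+ ((n + k)./2).
Proof.
move=> l_gt1 l_odd p_pr p_l r_prim lambda_r sigma_zeta m_ge3 hE k n x beta x0 xsigma.
have [G Gzw] := galois_exists l_gt1 p_pr p_l r_prim m_ge3.
have xs := poly_in_Cint_span xsigma.
have [H1 H2 H3 H4] := compositum_lattice l_gt1 l_odd p_pr p_l r_prim lambda_r sigma_zeta
  m_ge3 Gzw x0 xs hE.
exact: conj H1 (conj H2 (conj H3 H4)).
Qed.
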